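(* There are Martin-Löf tests $\mathcal W=(\mathcal W_i)_{i\in\omega}$ and $\mathcal V=(\mathcal V_i)_{i\in\omega}$ such that (i) $\mathcal W$ is universal, (ii) for every $i$ there is $j$ with $\mathcal V_j\subseteq\mathcal W_i$, and (iii) every function $f\colon\omega\to\omega$ satisfying $\mathcal V_{f(i)}\subseteq\mathcal W_i$ for all $i$ satisfies $f\ge_T 0''$.
   Context: Work in Cantor space $2^\omega$ with Lebesgue measure $\lambda$. For $\sigma\in 2^{<\omega}$, $[\sigma]=\{X\in 2^\omega:\sigma\prec X\}$. A sequence $(\mathcal U_i)_{i\in\omega}$ of open subsets of $2^\omega$ is uniformly effectively open if $\{\langle i,\sigma\rangle : [\sigma]\subseteq\mathcal U_i\}$ is computably enumerable. A Martin-Löf (ML) test is a uniformly effectively open sequence $(\mathcal V_i)_{i\in\omega}$ with $\lambda(\mathcal V_i)\le 2^{-i}$ for all $i$. An ML-test $\mathcal U$ is universal if $\bigcap_i\mathcal V_i\subseteq\bigcap_i\mathcal U_i$ for every ML-test $\mathcal V$. $0''$ denotes the second Turing jump of the empty set and $\ge_T$ Turing reducibility. *)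

(* Defs.v *)
From Stdlib Require Import List Arith Lia.
Import ListNotations.

Inductive prf : Type :=
| PZero : prf
| PSucc : prf
| PProj : nat -> prf
| PComp : prf -> list prf -> prf
| PRec  : prf -> prf -> prf
| PMu   : prf -> prf
| POracle : prf.

(* An oracle is given by its graph [O : nat -> nat -> Prop] ([O x y] means
   "the oracle answers y on query x"); for a total function [f] this is
   [fun x y => y = f x], for a set [P] its characteristic function. *)
Definition oracle := nat -> nat -> Prop.

Definition graph_fun (f : nat -> nat) : oracle := fun x y => y = f x.

Definition graph_set (P : nat -> Prop) : oracle :=
  fun x y => (P x /\ y = 1) \/ (~ P x /\ y = 0).

Inductive eval (O : oracle) : prf -> list nat -> nat -> Prop :=
| ev_zero v : eval O PZero v 0
| ev_succ x v : eval O PSucc (x :: v) (S x)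
| ev_proj i v : eval O (PProj i) v (nth i v 0)
| ev_comp f gs v ys y :
    Forall2 (fun g yg => eval O g v yg) gs ys ->
    eval O f ys y -> eval O (PComp f gs) v y
| ev_rec0 f g v y : eval O f v y -> eval O (PRec f g) (0 :: v) y
| ev_recS f g n v z y :
    eval O (PRec f g) (n :: v) z -> eval O g (n :: z :: v) y ->
    eval O (PRec f g) (S n :: v) y
| ev_mu f v n :
    eval O f (n :: v) 0 ->
    (forall m, m < n -> exists k, eval O f (m :: v) (S k)) ->
    eval O (PMu f) v n
| ev_oracle x v y : O x y -> eval O POracle (x :: v) y.

Definition set_computable_in (O : oracle) (Q : nat -> Prop) : Prop :=
  exists c : prf, forall x,
    (Q x -> eval O c [x] 1) /\ (~ Q x -> eval O c [x] 0).

Definition pair (a b : nat) : nat := (a + b) * (a + b + 1) / 2 + b.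

(* A fixed (injective, computable) Goedel numbering of codes. *)
Fixpoint code_prf (c : prf) : nat :=
  match c with
  | PZero => pair 0 0
  | PSucc => pair 1 0
  | PProj i => pair 2 i
  | PComp f gs =>
      let fix code_list (l : list prf) : nat :=
        match l with
        | [] => 0
        | g :: l' => S (pair (code_prf g) (code_list l'))
        end in
      pair 3 (pair (code_prf f) (code_list gs))
  | PRec f g => pair 4 (pair (code_prf f) (code_prf g))
  | PMu f => pair 5 (code_prf f)
  | POracle => pair 6 0
  end.

Definition jump (P : nat -> Prop) : nat -> Prop :=
  fun e => exists c : prf, e = code_prf c /\
                      exists y, eval (graph_set P) c [e] y.

Definition empty_set : nat -> Prop := fun _ => False.

Definition zero_jump2 : nat -> Prop := jump (jump empty_set).

Definition turing_above_0'' (f : nat -> nat) : Prop :=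
  set_computable_in (graph_fun f) zero_jump2.

Definition ce2 (R : nat -> nat -> Prop) : Prop :=
  exists c : prf, forall a b,
    R a b <-> exists y, eval (graph_set empty_set) c [a; b] y.

Definition cantor := nat -> bool.
Definition str := list bool.

Definition prefix (s : str) (X : cantor) : Prop :=
  forall k, k < length s -> nth k s false = X k.

Definition cyl_sub (s : str) (U : cantor -> Prop) : Prop :=
  forall X, prefix s X -> U X.

Definition open_set (U : cantor -> Prop) : Prop :=
  forall X, U X -> exists s, prefix s X /\ cyl_sub s U.

Definition set_sub (U V : cantor -> Prop) : Prop := forall X, U X -> V X.

(* bijective numbering of binary strings *)
Fixpoint code_str (s : str) : nat :=
  match s with
  | [] => 0
  | b :: s' => S (2 * code_str s' + (if b then 1 else 0))
  end.

Fixpoint all_strs (n : nat) : list str :=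
  match n with
  | 0 => [[]]
  | S n' => flat_map (fun t => [false :: t; true :: t]) (all_strs n')
  end.

Fixpoint is_prefix_str (s t : str) : bool :=
  match s, t with
  | [], _ => true
  | a :: s', b :: t' => Bool.eqb a b && is_prefix_str s' t'
  | _ :: _, [] => false
  end.

(* Lebesgue measure of the finite union of cylinders [s], s in L:
   it equals  count_cyl n L / 2^n  for n = max length of the strings in L. *)
Definition max_len (L : list str) : nat := fold_right (fun s m => Nat.max (length s) m) 0 L.

Definition count_cyl (n : nat) (L : list str) : nat :=
  length (filter (fun t => existsb (fun s => is_prefix_str s t) L) (all_strs n)).

(* lambda(U) <= 2^-i for an open set U: by inner regularity / countable
   additivity, lambda(U) is the supremum of the measures of finite unions of
   cylinders contained in U. *)
Definition measure_le_pow2 (U : cantor -> Prop) (i : nat) : Prop :=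
  forall L : list str, Forall (fun s => cyl_sub s U) L ->
    count_cyl (max_len L) L * 2 ^ i <= 2 ^ (max_len L).

Definition unif_eff_open (U : nat -> cantor -> Prop) : Prop :=
  (forall i, open_set (U i)) /\
  ce2 (fun i n => exists s, n = code_str s /\ cyl_sub s (U i)).

Definition ML_test (U : nat -> cantor -> Prop) : Prop :=
  unif_eff_open U /\ forall i, measure_le_pow2 (U i) i.

Definition universal_ML_test (U : nat -> cantor -> Prop) : Prop :=
  ML_test U /\
  forall V, ML_test V -> forall X, (forall i, V i X) -> forall i, U i X.

(* Main.v *)
Require Import Defs.
From Stdlib Require Import List Arith.
From Stdlib Require Import Lia Bool Cantor Classical ClassicalEpsilon.
Import ListNotations.

(** 0'' is a Delta_3 set: there is a decidable [witness] such that, writing [R(i, k)] for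
    [forall n, exists m, witness i k n m], every [i] has some [k] with [R(i, k)], and
    [R(i, k)] tells whether [i] is in 0'' by whether [k > 0].  Fix a universal test [U] and
    choose computably a sequence of disjoint cylinders [sigma_j], each avoiding
    what [U_0] has enumerated so far.  Outside these cylinders [W_i] copies
    [U_0] intersected with [U_i], enumerating only what misses the cylinders already chosen;
    inside [sigma_j] it contains [U_(i+j+2)], too small to cover [sigma_j], so that [W]
    is universal while the remaining content of [sigma_j] may be chosen freely.
    Let [V_p] be the union of the [sigma_<p,n>] over [n], and let [W_i] swallow
    [sigma_<<i,k>,n>] once some [m] satisfies [witness i k n m].  Then [V_p] is contained
    in [W_i] iff [p = <i,k>] with [R(i, k)], and such a [p] decides whether [i] is in 0''. *)

(** * Total functions computed without the oracle *)

(** Since [f] is arbitrary, every index p with V_p inside W_i has to reveal the answer, not only the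
    intended ones. So W_i must fail to cover each cylinder that it does not swallow on purpose,
    although universality forces it to contain the intersection of U. Adding all of U_i would be
    fatal, since U_i may be larger than sigma_j and cover it; hence the component of smaller measure
    inside sigma_j. Outside, one sequence of cylinders serves all i, and nothing enumerated into W_i
    before sigma_j is chosen may meet sigma_j. Intersecting with U_0 arranges this for every i at
    once, as the choice of sigma_j avoids what U_0 has enumerated. Room for the choice comes from a
    factor two: U_i has measure at most 2^-(i+1), so U_0 leaves one half free, and finitely many
    sigma_j, of measure 2^-(j+2), take strictly less than one half. Inclusion of V_p in W_i is a
    forall-exists fact, one event per cylinder; this is why R(i, k) has that form, and why the outer
    existential quantifier over k has to be answered by the value of [f]. *)

Definition PR (k : nat) (f : list nat -> nat) : Prop :=
  exists c, forall O v, length v = k -> eval O c v (f v).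

Definition PRB (k : nat) (p : list nat -> bool) : Prop :=
  PR k (fun v => Nat.b2n (p v)).

Lemma PR_ext k f g : (forall v, f v = g v) -> PR k f -> PR k g.
Proof. intros E [c H]. exists c. intros O v L. rewrite <- E. now apply H. Qed.

Lemma PRB_ext k f g : (forall v, f v = g v) -> PRB k f -> PRB k g.
Proof. intros E. apply PR_ext. intro v. now rewrite E. Qed.

Lemma PR_hd k : PR k (fun v => hd 0 v).
Proof.
  exists (PProj 0). intros O v _.
  replace (hd 0 v) with (nth 0 v 0) by now destruct v. constructor.
Qed.

Lemma PR_zero k : PR k (fun _ => 0).
Proof. exists PZero. intros; constructor. Qed.

Lemma PR_S k a : PR k a -> PR k (fun v => S (a v)).
Proof.
  intros [c H]. exists (PComp PSucc [c]). intros O v L.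
  apply ev_comp with [a v]; [|constructor].
  constructor; [now apply H | constructor].
Qed.

Lemma PR_const k n : PR k (fun _ => n).
Proof. induction n; [apply PR_zero | now apply (PR_S k (fun _ => n))]. Qed.

(** [PComp] hands the whole environment to each of its arguments, so dropping the first [j] entries
    has to be spelled out as a list of projections. *)
Lemma eval_projs O j v : j <= length v ->
  Forall2 (fun g y => eval O g v y) (map PProj (seq j (length v - j))) (skipn j v).
Proof.
  intro Hj. remember (length v - j) as m eqn:E.
  revert j Hj E. induction m as [|m IH]; intros j Hj E; simpl.
  - rewrite skipn_all2 by lia. constructor.
  - destruct (skipn j v) as [|x u] eqn:Es.
    { apply (f_equal (@length nat)) in Es. rewrite length_skipn in Es. simpl in Es. lia. }
    constructor.
    + replace x with (nth j v 0); [constructor|].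
      rewrite <- (firstn_skipn j v), Es, app_nth2; rewrite length_firstn; [|lia].
      now replace (j - Nat.min j (length v)) with 0 by lia.
    + replace u with (skipn (S j) v); [apply IH; lia|].
      change (S j) with (1 + j). rewrite <- skipn_skipn, Es. reflexivity.
Qed.

Lemma PR_tl k f : PR k f -> PR (S k) (fun w => f (tl w)).
Proof.
  intros [c H]. exists (PComp c (map PProj (seq 1 k))).
  intros O [|x v] L; [discriminate|]. injection L as L.
  apply ev_comp with v; [|now apply H].
  subst k. pose proof (eval_projs O 1 (x :: v)) as E. simpl in E.
  rewrite Nat.sub_0_r in E. apply E. lia.
Qed.

(* Under a binder, [hd 0 w] is the bound variable and [tl w] the environment. *)
Lemma PR_subst j k g a :
  PR (S k) (fun w => g (hd 0 w) (tl w)) -> PR (j + k) a ->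
  PR (j + k) (fun v => g (a v) (Nat.iter j (@tl nat) v)).
Proof.
  intros [cg Hg] [ca Ha]. exists (PComp cg (ca :: map PProj (seq j k))).
  intros O v L.
  assert (E : Nat.iter j (@tl nat) v = skipn j v).
  { clear. revert v. induction j as [|j IH]; intro v; [reflexivity|].
    simpl Nat.iter. rewrite IH. change (S j) with (1 + j).
    rewrite <- skipn_skipn. now destruct (skipn j v). }
  rewrite E. apply ev_comp with (a v :: skipn j v).
  - constructor; [now apply Ha|].
    replace k with (length v - j) by lia. apply eval_projs; lia.
  - apply (Hg O (a v :: skipn j v)). simpl. rewrite length_skipn. lia.
Qed.

Lemma PR_let k g a :
  PR (S k) (fun w => g (hd 0 w) (tl w)) -> PR k a -> PR k (fun v => g (a v) v).
Proof. exact (PR_subst 0 k g a). Qed.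

Lemma PR_rec k a g b :
  PR k a -> PR (S (S k)) (fun w => g (hd 0 w) (hd 0 (tl w)) (tl (tl w))) ->
  PR k b ->
  PR k (fun v => nat_rect (fun _ => nat) (a v) (fun n z => g n z v) (b v)).
Proof.
  intros [ca Ha] [cg Hg] Hb.
  apply (PR_let k (fun m v => nat_rect (fun _ => nat) (a v) (fun n z => g n z v) m));
    [|exact Hb].
  exists (PRec ca cg). intros O [|n v] L; [discriminate|]. injection L as L. simpl.
  induction n as [|n IH]; simpl.
  - constructor. now apply Ha.
  - eapply ev_recS; [exact IH|].
    apply (Hg O (n :: _ :: v)). simpl. now rewrite L.
Qed.

(** Weakening for a body that reads the environment only through [tl]. Unification would not find
    the function to give to [PR_tl], so [pattern] builds it; matching [h] with a constant function
    fails if [w] survives elsewhere, as in [hd 0 w]. *)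
Ltac pr_tl :=
  match goal with
  | |- PR (S ?k) (fun w => @?F w) =>
    let h := constr:(fun w : list nat =>
      ltac:(let t := eval cbv beta in (F w) in
            let t' := eval pattern (tl w) in t in
            match t' with ?g _ => exact g end)) in
    match h with (fun _ => ?g) => refine (PR_tl k g _); cbv beta end
  | |- PRB (S ?k) (fun w => @?F w) =>
    let h := constr:(fun w : list nat =>
      ltac:(let t := eval cbv beta in (F w) in
            let t' := eval pattern (tl w) in t in
            match t' with ?g _ => exact g end)) in
    match h with (fun _ => ?g) => refine (PR_tl k (fun w => Nat.b2n (g w)) _); cbv beta;
      match goal with |- PR ?k (fun w => Nat.b2n (@?p w)) => change (PRB k p) end end
  end.

Create HintDb pr.
#[global] Hint Extern 1 (PR (S _) _) => pr_tl : pr.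
#[global] Hint Extern 1 (PRB (S _) _) => pr_tl : pr.
#[global] Hint Resolve PR_const PR_hd PR_S PR_rec : pr.
Ltac pr := auto 100 with pr nocore.

Lemma PR_add k a b : PR k a -> PR k b -> PR k (fun v => a v + b v).
Proof.
  intros. apply PR_ext with (fun v => nat_rect (fun _ => nat) (b v) (fun _ z => S z) (a v));
    [|pr].
  intro v. induction (a v); simpl; congruence.
Qed.
#[global] Hint Resolve PR_add : pr.

Lemma PR_mul k a b : PR k a -> PR k b -> PR k (fun v => a v * b v).
Proof.
  intros. apply PR_ext with (fun v => nat_rect (fun _ => nat) 0 (fun _ z => b v + z) (a v));
    [|pr].
  intro v. induction (a v); simpl; congruence.
Qed.
#[global] Hint Resolve PR_mul : pr.

Lemma PR_pow k a b : PR k a -> PR k b -> PR k (fun v => a v ^ b v).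
Proof.
  intros. apply PR_ext with (fun v => nat_rect (fun _ => nat) 1 (fun _ z => a v * z) (b v));
    [|pr].
  intro v. induction (b v); simpl; congruence.
Qed.
#[global] Hint Resolve PR_pow : pr.

Lemma PR_pred k a : PR k a -> PR k (fun v => pred (a v)).
Proof.
  intros. apply PR_ext with (fun v => nat_rect (fun _ => nat) 0 (fun n _ => n) (a v));
    [|pr].
  intro v. now destruct (a v).
Qed.
#[global] Hint Resolve PR_pred : pr.

Lemma PR_sub k a b : PR k a -> PR k b -> PR k (fun v => a v - b v).
Proof.
  intros. apply PR_ext with (fun v => nat_rect (fun _ => nat) (a v) (fun _ z => pred z) (b v));
    [|pr].
  intro v. induction (b v); simpl; lia.
Qed.
#[global] Hint Resolve PR_sub : pr.

Lemma PR_if k p a b : PRB k p -> PR k a -> PR k b ->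
  PR k (fun v => if p v then a v else b v).
Proof.
  unfold PRB. intros.
  apply PR_ext with
    (fun v => nat_rect (fun _ => nat) (b v) (fun _ _ => a v) (Nat.b2n (p v)));
    [|pr].
  intro v. now destruct (p v).
Qed.
#[global] Hint Resolve PR_if : pr.

Lemma PRB_const k b : PRB k (fun _ => b).
Proof. unfold PRB. pr. Qed.
#[global] Hint Resolve PRB_const : pr.

Lemma PRB_negb k p : PRB k p -> PRB k (fun v => negb (p v)).
Proof.
  intros. apply PR_ext with (fun v => if p v then 0 else 1); [|pr].
  intro v. now destruct (p v).
Qed.
#[global] Hint Resolve PRB_negb : pr.

Lemma PRB_andb k p q : PRB k p -> PRB k q -> PRB k (fun v => p v && q v).
Proof.
  intros. apply PR_ext with (fun v => if p v then Nat.b2n (q v) else 0); [|pr].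
  intro v. now destruct (p v).
Qed.
#[global] Hint Resolve PRB_andb : pr.

Lemma PRB_orb k p q : PRB k p -> PRB k q -> PRB k (fun v => p v || q v).
Proof.
  intros. apply PR_ext with (fun v => if p v then 1 else Nat.b2n (q v)); [|pr].
  intro v. now destruct (p v).
Qed.
#[global] Hint Resolve PRB_orb : pr.

Lemma PRB_leb k a b : PR k a -> PR k b -> PRB k (fun v => a v <=? b v).
Proof.
  intros. apply PR_ext with (fun v => 1 - (a v - b v)); [|pr].
  intro v. destruct (Nat.leb_spec (a v) (b v)); unfold Nat.b2n; lia.
Qed.
#[global] Hint Resolve PRB_leb : pr.

Lemma PRB_eqb k a b : PR k a -> PR k b -> PRB k (fun v => a v =? b v).
Proof.
  intros. apply PR_ext with (fun v => 1 - ((a v - b v) + (b v - a v))); [|pr].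
  intro v. destruct (Nat.eqb_spec (a v) (b v)); unfold Nat.b2n; lia.
Qed.
#[global] Hint Resolve PRB_eqb : pr.

Fixpoint bsum (n : nat) (f : nat -> nat) : nat :=
  match n with 0 => 0 | S m => f m + bsum m f end.

Fixpoint bex (n : nat) (p : nat -> bool) : bool :=
  match n with 0 => false | S m => p m || bex m p end.

Definition ball (n : nat) (p : nat -> bool) : bool := negb (bex n (fun k => negb (p k))).

Lemma bex_true n p : bex n p = true <-> exists k, k < n /\ p k = true.
Proof.
  induction n as [|n IH]; simpl.
  - split; [discriminate | intros (k & H & _); lia].
  - rewrite orb_true_iff, IH. split.
    + intros [H | (k & H1 & H2)]; [exists n | exists k]; split; auto; lia.
    + intros (k & H1 & H2). destruct (Nat.eq_dec k n) as [->|]; [now left|].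
      right. exists k. split; auto; lia.
Qed.

Lemma ball_true n p : ball n p = true <-> forall k, k < n -> p k = true.
Proof.
  unfold ball. rewrite negb_true_iff, <- not_true_iff_false, bex_true. split.
  - intros H k Hk. destruct (p k) eqn:E; auto. destruct H. exists k. now rewrite E.
  - intros H (k & H1 & H2). now rewrite (H k H1) in H2.
Qed.

Lemma PR_bsum k f b : PR k b -> PR (S k) (fun w => f (hd 0 w) (tl w)) ->
  PR k (fun v => bsum (b v) (fun n => f n v)).
Proof.
  intros Hb Hf. apply PR_ext with
    (fun v => nat_rect (fun _ => nat) 0 (fun n z => f n v + z) (b v)).
  - intro v. induction (b v); simpl; congruence.
  - apply PR_rec; [pr| |pr]. apply PR_add; [|pr].
    apply (PR_subst 2 k f (fun w => hd 0 w)); pr.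
Qed.
#[global] Hint Resolve PR_bsum : pr.

Lemma PRB_bex k p b : PR k b -> PRB (S k) (fun w => p (hd 0 w) (tl w)) ->
  PRB k (fun v => bex (b v) (fun n => p n v)).
Proof.
  intros. apply PRB_ext with
    (fun v => negb (bsum (b v) (fun n => Nat.b2n (p n v)) =? 0)); [|pr].
  intro v. induction (b v) as [|n IH]; simpl; auto. rewrite <- IH.
  now destruct (p n v).
Qed.
#[global] Hint Resolve PRB_bex : pr.

Lemma PRB_ball k p b : PR k b -> PRB (S k) (fun w => p (hd 0 w) (tl w)) ->
  PRB k (fun v => ball (b v) (fun n => p n v)).
Proof. intros. unfold ball. pr. Qed.
#[global] Hint Resolve PRB_ball : pr.

Lemma PR_modulo k a b : PR k a -> PR k b -> PR k (fun v => a v mod b v).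
Proof.
  (* A counter that returns to 0 on reaching the modulus. Since [a mod 0 = a], modulus 0 has its own
     branch, which never resets. *)
  intros. apply PR_ext with (fun v => nat_rect (fun _ => nat) 0
    (fun _ z => if (b v =? 0) then S z else if S z =? b v then 0 else S z) (a v)); [|pr].
  intro v. symmetry. generalize (b v) as m. intro m. destruct (Nat.eq_dec m 0) as [->|Hm].
  - simpl. induction (a v); simpl; congruence.
  - set (F := fun _ z : nat => if m =? 0 then S z else if S z =? m then 0 else S z).
    induction (a v) as [|n IH]; [now apply Nat.Div0.mod_0_l|].
    change (S n mod m = F n (nat_rect (fun _ => nat) 0 F n)). rewrite <- IH.
    unfold F. apply Nat.eqb_neq in Hm as E. rewrite E.
    pose proof (Nat.mod_upper_bound n m Hm).
    pose proof (Nat.div_mod n m Hm).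
    destruct (Nat.eqb_spec (S (n mod m)) m); symmetry.
    + apply Nat.mod_unique with (S (n / m)); lia.
    + apply Nat.mod_unique with (n / m); lia.
Qed.
#[global] Hint Resolve PR_modulo : pr.

(** * Pairing and lists *)

Lemma pair_to_nat a b : pair a b = to_nat (a, b).
Proof.
  unfold pair, to_nat. set (F := fun i m => S i + m).
  assert (H : forall n, n * (n + 1) / 2 = nat_rec (fun _ => nat) 0 F n).
  { intro n. symmetry. apply Nat.div_unique with 0; [lia|]. rewrite Nat.add_0_r.
    induction n as [|n IH]; [reflexivity|].
    change (S n * (S n + 1) = 2 * (S n + nat_rec (fun _ => nat) 0 F n)). lia. }
  rewrite H, (Nat.add_comm b a). apply Nat.add_comm.
Qed.

Definition ufst (n : nat) : nat := fst (of_nat n).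
Definition usnd (n : nat) : nat := snd (of_nat n).

Lemma ufst_pair a b : ufst (pair a b) = a.
Proof. unfold ufst. now rewrite pair_to_nat, cancel_of_to. Qed.

Lemma usnd_pair a b : usnd (pair a b) = b.
Proof. unfold usnd. now rewrite pair_to_nat, cancel_of_to. Qed.

Lemma pair_eta n : pair (ufst n) (usnd n) = n.
Proof.
  unfold ufst, usnd. rewrite pair_to_nat, <- surjective_pairing. apply cancel_to_of.
Qed.

Lemma pair_inj a b c d : pair a b = pair c d -> a = c /\ b = d.
Proof.
  intro H. split; [rewrite <- (ufst_pair a b) | rewrite <- (usnd_pair a b)];
    rewrite H; [apply ufst_pair | apply usnd_pair].
Qed.

Lemma pair_ge a b : a + b <= pair a b.
Proof. rewrite pair_to_nat, Nat.add_comm. apply to_nat_non_decreasing. Qed.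

Lemma PR_pair k a b : PR k a -> PR k b -> PR k (fun v => pair (a v) (b v)).
Proof.
  intros. apply PR_ext with (fun v => bsum (S (a v + b v)) (fun n => n) + b v); [|pr].
  intro v. rewrite pair_to_nat. unfold to_nat. rewrite (Nat.add_comm (b v) (a v)).
  rewrite Nat.add_comm. f_equal. induction (a v + b v) as [|n IH]; [reflexivity|].
  change (S n + bsum (S n) (fun n => n) =
          S n + nat_rec (fun _ => nat) 0 (fun i m => S i + m) n).
  now rewrite IH.
Qed.
#[global] Hint Resolve PR_pair : pr.

(** No formula for the inverse is programmed: both components are bounded by the code, so a double
    bounded sum over all candidates picks out the single matching pair. *)
Lemma PR_unpair k f a :
  PR (S (S k)) (fun w => f (hd 0 (tl w)) (hd 0 w)) -> PR k a ->
  PR k (fun v => f (ufst (a v)) (usnd (a v))).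
Proof.
  intros Hf Ha.
  apply PR_ext with (fun v => bsum (S (a v)) (fun x => bsum (S (a v))
    (fun y => if pair x y =? a v then f x y else 0))).
  - intro v. set (x0 := ufst (a v)). set (y0 := usnd (a v)).
    assert (E : pair x0 y0 = a v) by apply pair_eta.
    pose proof (pair_ge x0 y0) as G. rewrite E in G.
    assert (B : forall h n z, (forall m, m <> z -> h m = 0) ->
              bsum n h = if z <? n then h z else 0).
    { intros h n z Hh. induction n as [|n IH]; cbn [bsum]; [reflexivity|].
      rewrite IH. destruct (Nat.eq_dec n z) as [->|Hn].
      - rewrite Nat.ltb_irrefl. destruct (Nat.ltb_spec z (S z)); lia.
      - rewrite (Hh n Hn). destruct (Nat.ltb_spec z n), (Nat.ltb_spec z (S n)); lia. }
    rewrite (B _ _ x0), (B _ _ y0).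
    + destruct (Nat.ltb_spec x0 (S (a v))); [|lia].
      destruct (Nat.ltb_spec y0 (S (a v))); [|lia].
      now rewrite E, Nat.eqb_refl.
    + intros m Hm. destruct (Nat.eqb_spec (pair x0 m) (a v)) as [H|]; auto.
      rewrite <- E in H. apply pair_inj in H. lia.
    + intros m Hm. rewrite (B _ _ y0).
      * destruct (Nat.eqb_spec (pair m y0) (a v)) as [H|]; [|now destruct (y0 <? S (a v))].
        rewrite <- E in H. apply pair_inj in H. lia.
      * intros m' Hm'. destruct (Nat.eqb_spec (pair m m') (a v)) as [H|]; auto.
        rewrite <- E in H. apply pair_inj in H. lia.
  - apply PR_bsum; [pr|]. apply PR_bsum; [pr|]. apply PR_if; [pr| |pr];  pr.
Qed.

Lemma PR_ufst k a : PR k a -> PR k (fun v => ufst (a v)).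
Proof. apply (PR_unpair k (fun x _ => x)). pr. Qed.

Lemma PR_usnd k a : PR k a -> PR k (fun v => usnd (a v)).
Proof. apply (PR_unpair k (fun _ y => y)). pr. Qed.
#[global] Hint Resolve PR_ufst PR_usnd : pr.

Definition ncons (x l : nat) : nat := S (pair x l).
Definition nhd (n : nat) : nat := ufst (pred n).
Definition ntl (n : nat) : nat := usnd (pred n).

Definition lcode (l : list nat) : nat := fold_right ncons 0 l.

Definition nnth (i l : nat) : nat := nhd (nat_rect (fun _ => nat) l (fun _ z => ntl z) i).

(** The state pairs what is still to be reversed with what is done. The code [l] doubles as step
    count: a list is never longer than its code, and surplus steps change nothing. *)
Definition nrev (l : nat) : nat :=
  usnd (nat_rect (fun _ => nat) (pair l 0)
    (fun _ z => if ufst z =? 0 then z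
                else pair (ntl (ufst z)) (ncons (nhd (ufst z)) (usnd z))) l).

Lemma nhd_cons x l : nhd (ncons x l) = x.
Proof. apply ufst_pair. Qed.

Lemma ntl_cons x l : ntl (ncons x l) = l.
Proof. apply usnd_pair. Qed.

Lemma ncons_eqb0 x l : (ncons x l =? 0) = false.
Proof. reflexivity. Qed.

Lemma ncons_eta n : n <> 0 -> ncons (nhd n) (ntl n) = n.
Proof.
  intro H. destruct n; [easy|]. unfold ncons, nhd, ntl. simpl. now rewrite pair_eta.
Qed.

Lemma ncons_inj x l y m : ncons x l = ncons y m -> x = y /\ l = m.
Proof. intro H. injection H. apply pair_inj. Qed.

Create HintDb un.
#[global] Hint Rewrite ufst_pair usnd_pair nhd_cons ntl_cons ncons_eqb0 : un.

Lemma lcode_surj n : exists l, n = lcode l.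
Proof.
  induction n as [n IH] using (well_founded_induction lt_wf).
  destruct (Nat.eq_dec n 0) as [->|H]; [now exists []|].
  pose proof (ncons_eta n H) as E. pose proof (pair_ge (nhd n) (ntl n)).
  destruct (IH (ntl n)) as [l Hl]; [unfold ncons in E; lia|].
  exists (nhd n :: l). simpl. now rewrite <- Hl.
Qed.

Lemma nnth_lcode i l : nnth i (lcode l) = nth i l 0.
Proof.
  (* 0 unpairs to 0 and 0, so walking past the end yields 0, the default value of [nth]. *)
  assert (Z : ufst 0 = 0 /\ usnd 0 = 0) by now compute.
  unfold nnth.
  assert (E : nat_rect (fun _ => nat) (lcode l) (fun _ z => ntl z) i = lcode (skipn i l)).
  { revert l. induction i as [|i IH]; intro l; [reflexivity|].
    simpl nat_rect. rewrite IH. clear IH. revert l.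
    induction i as [|i IH]; intros [|x l]; try apply Z; simpl; autorewrite with un; auto. }
  rewrite E. rewrite <- (Nat.add_0_r i) at 2. rewrite <- nth_skipn.
  destruct (skipn i l); [apply Z | apply nhd_cons].
Qed.

Lemma nrev_lcode l : nrev (lcode l) = lcode (rev l).
Proof.
  unfold nrev.
  set (F := fun _ z : nat => if ufst z =? 0 then z
                else pair (ntl (ufst z)) (ncons (nhd (ufst z)) (usnd z))).
  assert (G : forall n l, length l <= n -> forall acc,
    nat_rect (fun _ => nat) (pair (lcode l) (lcode acc)) F n = pair 0 (lcode (rev l ++ acc))).
  { assert (S1 : forall n st, nat_rect (fun _ => nat) st F (S n) =
                 nat_rect (fun _ => nat) (F 0 st) F n).
    { intros n st. induction n as [|n IH]; [reflexivity|].
      change (F 0 (nat_rect (fun _ => nat) st F (S n)) =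
              F 0 (nat_rect (fun _ => nat) (F 0 st) F n)). now rewrite IH. }
    assert (F0 : forall a, F 0 (pair 0 a) = pair 0 a)
      by (intro; unfold F; now autorewrite with un).
    assert (F1 : forall x u a, F 0 (pair (ncons x u) a) = pair u (ncons x a))
      by (intros; unfold F; now autorewrite with un).
    induction n as [|n IH]; intros [|x u] L acc; simpl in L; try lia; [reflexivity| |];
      rewrite S1; simpl lcode; rewrite ?F0, ?F1.
    - apply (IH []); simpl; lia.
    - change (ncons x (lcode acc)) with (lcode (x :: acc)). rewrite (IH u) by lia.
      simpl. now rewrite <- app_assoc. }
  change 0 with (lcode []) at 1. rewrite G, usnd_pair, app_nil_r; [reflexivity|].
  clear. induction l as [|x l IH]; simpl; [lia|].
  pose proof (pair_ge x (lcode l)). unfold ncons. lia.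
Qed.

Lemma PR_ncons k a b : PR k a -> PR k b -> PR k (fun v => ncons (a v) (b v)).
Proof. intros. unfold ncons. pr. Qed.

Lemma PR_nhd k a : PR k a -> PR k (fun v => nhd (a v)).
Proof. intros. unfold nhd. pr. Qed.

Lemma PR_ntl k a : PR k a -> PR k (fun v => ntl (a v)).
Proof. intros. unfold ntl. pr. Qed.
#[global] Hint Resolve PR_ncons PR_nhd PR_ntl : pr.

Lemma PR_nnth k a b : PR k a -> PR k b -> PR k (fun v => nnth (a v) (b v)).
Proof. intros. unfold nnth. pr. Qed.

Lemma PR_nrev k a : PR k a -> PR k (fun v => nrev (a v)).
Proof. intros. unfold nrev. pr. Qed.
#[global] Hint Resolve PR_nnth PR_nrev : pr.

(** * A universal machine *)

(** A state [pair r K] holds the last computed value [r] and a stack [K] of tasks. *)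
Definition fEv (c v : nat) : nat := pair 0 (pair c v).
Definition fArgs (gs acc v f : nat) : nat := pair 1 (pair (pair gs acc) (pair v f)).
Definition fArgK (gs acc v f : nat) : nat := pair 2 (pair (pair gs acc) (pair v f)).
Definition fRec (g n w : nat) : nat := pair 3 (pair g (pair n w)).
Definition fMu (f v n : nat) : nat := pair 4 (pair f (pair v n)).
(* [fCk] only verifies that a number is the code of some program: in a recursion
   stopping at 0 the step program is never run, yet it has to be a code. *)
Definition fCk (c : nat) : nat := pair 5 c.
Definition fCkL (l : nat) : nat := pair 6 l.

(** The tags are those of [code_prf]. On a malformed task the state [st] is returned unchanged, so
    that the machine loops there and never empties its stack. *)
Definition step_ev (g : nat -> nat) (c v r K st : nat) : nat :=
  let t := ufst c in
  let d := usnd c in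
  if t =? 0 then (if d =? 0 then pair 0 K else st)
  else if t =? 1 then (if (d =? 0) && negb (v =? 0) then pair (S (nhd v)) K else st)
  else if t =? 2 then pair (nnth d v) K
  else if t =? 3 then pair r (ncons (fArgs (usnd d) 0 v (ufst d)) K)
  else if t =? 4 then
    (if v =? 0 then st
     else if nhd v =? 0
     then pair r (ncons (fCk (usnd d)) (ncons (fEv (ufst d) (ntl v)) K))
     else pair r (ncons (fEv c (ncons (pred (nhd v)) (ntl v)))
                    (ncons (fRec (usnd d) (pred (nhd v)) (ntl v)) K)))
  else if t =? 5 then pair r (ncons (fEv d (ncons 0 v)) (ncons (fMu d v 0) K))
  else if t =? 6 then (if (d =? 0) && negb (v =? 0) then pair (g (nhd v)) K else st)
  else st.

Definition step_ck (c r K st : nat) : nat :=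
  let t := ufst c in
  let d := usnd c in
  if (t =? 0) || (t =? 1) || (t =? 6) then (if d =? 0 then pair r K else st)
  else if t =? 2 then pair r K
  else if t =? 3 then pair r (ncons (fCk (ufst d)) (ncons (fCkL (usnd d)) K))
  else if t =? 4 then pair r (ncons (fCk (ufst d)) (ncons (fCk (usnd d)) K))
  else if t =? 5 then pair r (ncons (fCk d) K)
  else st.

Definition step_frame (g : nat -> nat) (t d r K st : nat) : nat :=
  let gs := ufst (ufst d) in
  let acc := usnd (ufst d) in
  let a := ufst d in
  let b := ufst (usnd d) in
  let c := usnd (usnd d) in
  if t =? 0 then step_ev g (ufst d) (usnd d) r K st
  else if t =? 1 then
    (if gs =? 0 then pair r (ncons (fEv c (nrev acc)) K)
     else pair r (ncons (fEv (nhd gs) b) (ncons (fArgK (ntl gs) acc b c) K)))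
  else if t =? 2 then pair r (ncons (fArgs gs (ncons r acc) b c) K)
  else if t =? 3 then pair r (ncons (fEv a (ncons b (ncons r c))) K)
  else if t =? 4 then
    (if r =? 0 then pair c K
     else pair r (ncons (fEv a (ncons (S c) b)) (ncons (fMu a b (S c)) K)))
  else if t =? 5 then step_ck d r K st
  else if t =? 6 then
    (if d =? 0 then pair r K
     else pair r (ncons (fCk (nhd d)) (ncons (fCkL (ntl d)) K)))
  else st.

Definition step (g : nat -> nat) (st : nat) : nat :=
  if usnd st =? 0 then st
  else step_frame g (ufst (nhd (usnd st))) (usnd (nhd (usnd st))) (ufst st)
         (ntl (usnd st)) st.

Definition run (g : nat -> nat) (n st : nat) : nat :=
  nat_rect (fun _ => nat) st (fun _ z => step g z) n.

(** The oracle answer [g x v] may depend on the environment. This allows runs whose oracle is a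
    computable approximation to 0', the stage of the approximation being an argument. *)
Lemma PR_step k g st : PR (S k) (fun w => g (hd 0 w) (tl w)) -> PR k st ->
  PR k (fun v => step (fun x => g x v) (st v)).
Proof.
  intros Hg Hst.
  assert (L : forall a, PR k a -> PR k (fun v => g (a v) v))
    by (intros; now apply PR_let).
  unfold step, step_frame, step_ev, step_ck, fEv, fArgs, fArgK, fRec, fMu, fCk, fCkL.
  cbv zeta. pr.
Qed.

Lemma PR_run k g n st : PR (S k) (fun w => g (hd 0 w) (tl w)) -> PR k n -> PR k st ->
  PR k (fun v => run (fun x => g x v) (n v) (st v)).
Proof.
  intros Hg Hn Hst. unfold run. apply PR_rec; [pr| |pr].
  apply (PR_step (S (S k)) (fun x w => g x (tl (tl w)))); [|pr].
  apply (PR_subst 3 k g (fun w => hd 0 w)); pr.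
Qed.

(** The generated principle has no hypothesis for the programs in the list of a [PComp]. *)
Lemma prf_nested_ind (P : prf -> Prop) :
  P PZero -> P PSucc -> (forall i, P (PProj i)) ->
  (forall f gs, P f -> Forall P gs -> P (PComp f gs)) ->
  (forall f g, P f -> P g -> P (PRec f g)) ->
  (forall f, P f -> P (PMu f)) -> P POracle -> forall c, P c.
Proof.
  intros Hz Hs Hp Hc Hr Hm Ho. fix IH 1.
  intros [| |i|f gs|f g|f|]; [exact Hz | exact Hs | apply Hp | | | apply Hm, IH | exact Ho].
  - apply Hc; [apply IH|]. induction gs as [|g gs IHgs]; constructor; [apply IH | apply IHgs].
  - apply Hr; apply IH.
Qed.

Lemma code_prf_comp f gs :
  code_prf (PComp f gs) = pair 3 (pair (code_prf f) (lcode (map code_prf gs))).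
Proof.
  simpl. do 2 f_equal. induction gs as [|g gs IH]; [reflexivity|].
  simpl. unfold ncons. now rewrite IH.
Qed.

Opaque pair ufst usnd ncons nhd ntl.

Lemma lcode_inj l m : lcode l = lcode m -> l = m.
Proof.
  revert m. induction l as [|x l IH]; intros [|y m]; simpl; try easy.
  intro H. apply ncons_inj in H as [-> H]. f_equal. auto.
Qed.

Lemma code_prf_inj c d : code_prf c = code_prf d -> c = d.
Proof.
  revert d. induction c as [| |i|f gs IHf IHgs|f g IHf IHg|f IHf|] using prf_nested_ind;
    intros [| |i'|f' gs'|f' g'|f'|] H; rewrite ?code_prf_comp in H; simpl in H;
    apply pair_inj in H as [E H]; try discriminate E; try easy.
  - now subst.
  - apply pair_inj in H as [H1 H2]. apply lcode_inj in H2. f_equal; [now apply IHf|].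
    clear -IHgs H2. revert gs' H2.
    induction IHgs as [|g gs Hg _ IH]; intros [|g' gs']; simpl; try easy.
    intro H. injection H as H H'. f_equal; auto.
  - apply pair_inj in H as [H1 H2]. f_equal; auto.
  - f_equal. auto.
Qed.

Lemma lcode_nil : lcode [] = 0.
Proof. reflexivity. Qed.

Lemma lcode_cons x l : lcode (x :: l) = ncons x (lcode l).
Proof. reflexivity. Qed.
#[global] Hint Rewrite lcode_nil lcode_cons : un.

(** * Correctness of the machine *)

Lemma run_add g m n st : run g (m + n) st = run g m (run g n st).
Proof. induction m as [|m IH]; simpl; [reflexivity|]. now rewrite IH. Qed.

Definition runs (g : nat -> nat) (st st' : nat) : Prop := exists n, run g n st = st'.

Lemma runs_refl g st : runs g st st.
Proof. now exists 0. Qed.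

Lemma runs_trans g a b c : runs g a b -> runs g b c -> runs g a c.
Proof. intros [m <-] [n <-]. exists (n + m). apply run_add. Qed.

Lemma runs_step g a b : runs g (step g a) b -> runs g a b.
Proof. apply runs_trans. now exists 1. Qed.

Ltac unstep :=
  unfold step, step_frame, fEv, fArgs, fArgK, fRec, fMu, fCk, fCkL, step_ev, step_ck;
  cbv zeta; repeat (autorewrite with un; cbn [Nat.eqb negb orb andb pred]).

Lemma runs_ck g c r K : runs g (pair r (ncons (fCk (code_prf c)) K)) (pair r K).
Proof.
  revert r K. induction c as [| |i|f gs IHf IHgs|f h IHf IHh|f IHf|] using prf_nested_ind;
    intros r K; apply runs_step; rewrite ?code_prf_comp; simpl code_prf; unstep;
    try apply runs_refl.
  - eapply runs_trans; [apply IHf|].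
    clear -IHgs. induction IHgs as [|x gs Hx _ IH]; apply runs_step; simpl map; unstep.
    + apply runs_refl.
    + eapply runs_trans; [apply Hx | apply IH].
  - eapply runs_trans; [apply IHf | apply IHh].
  - apply IHf.
Qed.

Definition ofun (O : oracle) (g : nat -> nat) : Prop := forall x y, O x y <-> y = g x.

Lemma runs_eval O g c v y : ofun O g -> eval O c v y -> forall r K,
  runs g (pair r (ncons (fEv (code_prf c) (lcode v)) K)) (pair y K).
Proof.
  intro HO. revert v y.
  induction c as [| |i|f gs IHf IHgs|f h IHf IHh|f IHf|] using prf_nested_ind;
    intros v y Hy.
  - inversion Hy; subst. intros. apply runs_step. simpl code_prf. unstep. apply runs_refl.
  - inversion Hy; subst. intros. apply runs_step. simpl code_prf. unstep. apply runs_refl.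
  - inversion Hy; subst. intros. apply runs_step. simpl code_prf. unstep.
    rewrite nnth_lcode. apply runs_refl.
  - inversion Hy as [| | |f' gs' v' ys y' H1 H2| | | |]; subst. intros.
    apply runs_step. rewrite code_prf_comp. unstep.
    change (fArgs (lcode (map code_prf gs)) 0)
      with (fArgs (lcode (map code_prf gs)) (lcode [])). change ys with (rev [] ++ ys) in H2.
    clear Hy. revert r H2. generalize (@nil nat) as acc.
    induction H1 as [|x y0 gs ys Hx _ IH]; intros acc r H2; apply runs_step; simpl map; unstep.
    + rewrite nrev_lcode. rewrite app_nil_r in H2. now apply IHf.
    + inversion IHgs; subst. eapply runs_trans; [eauto|]. apply runs_step. unstep.
      change (ncons y0 (lcode acc)) with (lcode (y0 :: acc)). apply IH; auto.
      simpl. now rewrite <- app_assoc.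
  - assert (G : forall n w y, eval O (PRec f h) (n :: w) y -> forall r K,
      runs g (pair r (ncons (fEv (code_prf (PRec f h)) (lcode (n :: w))) K)) (pair y K)).
    { clear v y Hy. induction n as [|n IH]; intros w y Hy r K; inversion Hy; subst;
        apply runs_step; simpl code_prf; unstep.
      - eapply runs_trans; [apply runs_ck | now apply IHf].
      - eapply runs_trans; [apply (IH w); eassumption|].
        apply runs_step. unstep.
        match goal with |- context [ncons n (ncons ?z (lcode w))] =>
          change (ncons n (ncons z (lcode w))) with (lcode (n :: z :: w)) end.
        now apply IHh. }
    inversion Hy; subst; now apply G.
  - inversion Hy as [| | | | | |f' v' n H1 H2|]; subst. intros.
    apply runs_step. simpl code_prf. unstep.
    (* [d] is the distance from the candidate [m] to the least zero [y]; every candidate on the way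
       has a positive value. *)
    assert (G : forall d m r, m + d = y ->
      runs g (pair r (ncons (fEv (code_prf f) (lcode (m :: v)))
         (ncons (fMu (code_prf f) (lcode v) m) K))) (pair y K)).
    { induction d as [|d IH]; intros m s Hd.
      - replace m with y by lia. eapply runs_trans; [apply IHf; exact H1|].
        apply runs_step. unstep. apply runs_refl.
      - destruct (H2 m) as [k Hk]; [lia|]. eapply runs_trans; [apply IHf; exact Hk|].
        apply runs_step. unstep. apply (IH (S m)). lia. }
    now apply (G y 0).
  - inversion Hy; subst. intros. apply runs_step. simpl code_prf. unstep.
    apply HO in H. subst. apply runs_refl.
Qed.

(** The task [F], started with last value [r], can finish with value [s]: this invariant is
    pulled back along [step] to show that halting computations are evaluations. *)
Inductive frel (O : oracle) : nat -> nat -> nat -> Prop := (* F, r, s *)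
| fr_ev c v r y : eval O c v y -> frel O (fEv (code_prf c) (lcode v)) r y
| fr_args gs acc v f ys r y :
    Forall2 (fun g z => eval O g v z) gs ys -> eval O f (rev acc ++ ys) y ->
    frel O (fArgs (lcode (map code_prf gs)) (lcode acc) (lcode v) (code_prf f)) r y
| fr_argk gs acc v f ys r y :
    Forall2 (fun g z => eval O g v z) gs ys -> eval O f (rev acc ++ r :: ys) y ->
    frel O (fArgK (lcode (map code_prf gs)) (lcode acc) (lcode v) (code_prf f)) r y
| fr_rec g n w r y : eval O g (n :: r :: w) y ->
    frel O (fRec (code_prf g) n (lcode w)) r y
| fr_mu0 c v n : frel O (fMu c v n) 0 n
| fr_muS f v n r y : n < y -> eval O f (y :: v) 0 ->
    (forall m, n < m < y -> exists k, eval O f (m :: v) (S k)) ->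
    frel O (fMu (code_prf f) (lcode v) n) (S r) y
| fr_ck c r : frel O (fCk (code_prf c)) r r
| fr_ckl cs r : frel O (fCkL (lcode (map code_prf cs))) r r.

Inductive complete (O : oracle) : nat -> Prop :=
| co_nil r : complete O (pair r 0)
| co_cons F K r s : frel O F r s -> complete O (pair s K) ->
    complete O (pair r (ncons F K)).

Lemma complete_cons_inv O F K r : complete O (pair r (ncons F K)) ->
  exists s, frel O F r s /\ complete O (pair s K).
Proof.
  intro H. remember (pair r (ncons F K)) as st eqn:E. destruct H as [r'|F' K' r' s H1 H2].
  - apply pair_inj in E as [_ E]. apply (f_equal (fun n => n =? 0)) in E.
    rewrite ncons_eqb0 in E. discriminate E.
  - apply pair_inj in E as [-> E]. apply ncons_inj in E as [-> ->]. eauto.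
Qed.

Ltac frel_inv :=
  let E := fresh "E" in
  match goal with |- frel ?O ?F ?r ?s -> _ =>
    let H := fresh "H" in
    remember F as F0 eqn:E; intro H; destruct H;
    unfold fEv, fArgs, fArgK, fRec, fMu, fCk, fCkL in E;
    repeat match goal with
           | E : pair _ _ = pair _ _ |- _ =>
             let E' := fresh "E" in apply pair_inj in E as [E' E]
           end; try discriminate end.

Lemma frel_ev_inv O c v r y : frel O (fEv c v) r y ->
  exists p u, c = code_prf p /\ v = lcode u /\ eval O p u y.
Proof. frel_inv. subst. eauto. Qed.

Lemma frel_args_inv O gs acc v f r y : frel O (fArgs gs acc v f) r y ->
  exists gs' acc' v' f' ys, gs = lcode (map code_prf gs') /\ acc = lcode acc' /\
    v = lcode v' /\ f = code_prf f' /\ Forall2 (fun g z => eval O g v' z) gs' ys /\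
    eval O f' (rev acc' ++ ys) y.
Proof. frel_inv. subst. repeat eexists; eauto. Qed.

Lemma frel_argk_inv O gs acc v f r y : frel O (fArgK gs acc v f) r y ->
  exists gs' acc' v' f' ys, gs = lcode (map code_prf gs') /\ acc = lcode acc' /\
    v = lcode v' /\ f = code_prf f' /\ Forall2 (fun g z => eval O g v' z) gs' ys /\
    eval O f' (rev acc' ++ r :: ys) y.
Proof. frel_inv. subst. repeat eexists; eauto. Qed.

Lemma frel_rec_inv O g n w r y : frel O (fRec g n w) r y ->
  exists g' w', g = code_prf g' /\ w = lcode w' /\ eval O g' (n :: r :: w') y.
Proof. frel_inv. subst. eauto. Qed.

Lemma frel_mu_inv O f v n r y : frel O (fMu f v n) r y ->
  r = 0 /\ y = n \/
  exists f' v', f = code_prf f' /\ v = lcode v' /\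
    0 < r /\ n < y /\ eval O f' (y :: v') 0 /\
    (forall m, n < m < y -> exists k, eval O f' (m :: v') (S k)).
Proof.
  frel_inv; subst; [now left | right].
  do 2 eexists. repeat split; eauto. lia.
Qed.

Lemma frel_ck_inv O c r y : frel O (fCk c) r y -> r = y /\ exists p, c = code_prf p.
Proof. frel_inv. subst. eauto. Qed.

Lemma frel_ckl_inv O l r y : frel O (fCkL l) r y ->
  r = y /\ exists cs, l = lcode (map code_prf cs).
Proof. frel_inv. subst. eauto. Qed.

Lemma pair_surj n : exists a b, n = pair a b.
Proof. exists (ufst n), (usnd n). now rewrite pair_eta. Qed.

Lemma ncons_surj n : n = 0 \/ exists a b, n = ncons a b.
Proof.
  destruct (Nat.eq_dec n 0) as [|H]; [now left|right].
  exists (nhd n), (ntl n). now rewrite ncons_eta.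
Qed.

Lemma lcode_inv0 l : 0 = lcode l -> l = [].
Proof. change 0 with (lcode []). intro H. symmetry. now apply lcode_inj. Qed.

Lemma lcode_inv_cons x y l : ncons x y = lcode l -> exists u, l = x :: u /\ y = lcode u.
Proof.
  destruct l as [|z u]; intro H.
  - apply (f_equal (fun n => n =? 0)) in H. now rewrite ncons_eqb0 in H.
  - apply ncons_inj in H as [-> ->]. eauto.
Qed.

Ltac co_inv H r :=
  let F := fresh "F" in apply complete_cons_inv in H as (r & F & H);
  first [ apply frel_ev_inv in F as (? & ? & ? & ? & ?)
        | apply frel_args_inv in F as (? & ? & ? & ? & ? & ? & ? & ? & ? & ? & ?)
        | apply frel_argk_inv in F as (? & ? & ? & ? & ? & ? & ? & ? & ? & ? & ?)
        | apply frel_rec_inv in F as (? & ? & ? & ? & ?)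
        | apply frel_mu_inv in F
        | apply frel_ck_inv in F as (? & ? & ?)
        | apply frel_ckl_inv in F as (? & ? & ?) ].

Lemma frel_ev' O p v c r y : c = code_prf p -> eval O p v y -> frel O (fEv c (lcode v)) r y.
Proof. intros ->. apply fr_ev. Qed.

Lemma frel_ck' O p c r : c = code_prf p -> frel O (fCk c) r r.
Proof. intros ->. apply fr_ck. Qed.

(** The tasks pushed by the step are inverted, and the evaluations they yield are reassembled into
    one for the popped task. A malformed task leaves the state unchanged, and then the hypothesis is
    the goal. *)
Lemma complete_step_ev O g c v r K : ofun O g ->
  complete O (step_ev g c v r K (pair r (ncons (fEv c v) K))) ->
  complete O (pair r (ncons (fEv c v) K)).
Proof.
  intros HO H. destruct (pair_surj c) as (t & d & ->). unfold step_ev in H.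
  cbv zeta in H. autorewrite with un in H.
  destruct t as [|[|[|[|[|[|[|t]]]]]]]; cbn [Nat.eqb] in H.
  - destruct (Nat.eqb_spec d 0) as [Ed|]; [subst d|exact H].
    destruct (lcode_surj v) as [u ->].
    eapply co_cons; [|exact H]. apply (frel_ev' O PZero); [reflexivity | constructor].
  - destruct (Nat.eqb_spec d 0) as [Ed|]; [subst d|exact H].
    destruct (ncons_surj v) as [->|(x & w & ->)]; [exact H|].
    autorewrite with un in H. cbn [negb andb] in H.
    destruct (lcode_surj w) as [u ->]. rewrite <- lcode_cons.
    eapply co_cons; [|exact H]. apply (frel_ev' O PSucc); [reflexivity | constructor].
  - destruct (lcode_surj v) as [u ->]. rewrite nnth_lcode in H.
    eapply co_cons; [|exact H]. apply (frel_ev' O (PProj d)); [reflexivity | constructor].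
  - destruct (pair_surj d) as (f & gs & ->). autorewrite with un in H. co_inv H s. subst.
    match goal with E : 0 = lcode _ |- _ => apply lcode_inv0 in E; subst end.
    eapply co_cons; [|exact H]. eapply frel_ev'; [symmetry; apply code_prf_comp|].
    econstructor; eauto.
  - destruct (pair_surj d) as (f & h & ->). autorewrite with un in H.
    destruct (ncons_surj v) as [->|(x & w & ->)]; [exact H|].
    autorewrite with un in H. destruct x as [|n]; cbn [Nat.eqb pred] in H.
    (* The first inversion is of the [fCk] task: it supplies the step program that [PRec] has to
       carry although the base case never runs it. *)
    + co_inv H s. co_inv H s'. subst. rewrite <- lcode_cons.
      eapply co_cons; [|exact H].
      eapply (frel_ev' _ (PRec _ _)); [reflexivity|]. now constructor.
    + co_inv H s. co_inv H s'. subst.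
      match goal with E : ncons n _ = lcode _ |- _ =>
        apply lcode_inv_cons in E as (u & -> & E); apply lcode_inj in E; subst end.
      rewrite <- lcode_cons. eapply co_cons; [|exact H].
      match goal with E : pair 4 (pair f _) = code_prf ?p |- _ =>
        apply (frel_ev' _ p); [exact E|]; destruct p; rewrite ?code_prf_comp in E;
        apply pair_inj in E as [E E']; try discriminate E;
        apply pair_inj in E' as [_ E']; apply code_prf_inj in E'; subst end.
      econstructor; eauto.
  - co_inv H s. co_inv H s'. subst.
    match goal with E : ncons 0 _ = lcode _ |- _ =>
      apply lcode_inv_cons in E as (u & -> & ->) end.
    eapply co_cons; [|exact H]. eapply (frel_ev' _ (PMu _)); [reflexivity|].
    destruct F as [[-> ->]|(f' & v' & Ef & Ev & Hs & Hs' & F1 & F2)].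
    + constructor; [assumption | lia].
    + apply code_prf_inj in Ef. apply lcode_inj in Ev. subst.
      constructor; [assumption|]. intros [|m] Hm; [|apply F2; lia].
      destruct s as [|s]; [lia|]. eauto.
  - destruct (Nat.eqb_spec d 0) as [Ed|]; [subst d|exact H].
    destruct (ncons_surj v) as [->|(x & w & ->)]; [exact H|].
    autorewrite with un in H. cbn [negb andb] in H.
    destruct (lcode_surj w) as [u ->]. rewrite <- lcode_cons.
    eapply co_cons; [|exact H]. apply (frel_ev' O POracle); [reflexivity|].
    constructor. now apply HO.
  - exact H.
Qed.

Lemma complete_step_ck O c r K :
  complete O (step_ck c r K (pair r (ncons (fCk c) K))) ->
  complete O (pair r (ncons (fCk c) K)).
Proof.
  intro H. destruct (pair_surj c) as (t & d & ->). unfold step_ck in H.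
  cbv zeta in H. autorewrite with un in H.
  destruct t as [|[|[|[|[|[|[|t]]]]]]]; cbn [Nat.eqb orb] in H.
  - destruct (Nat.eqb_spec d 0) as [Ed|]; [subst d|exact H].
    eapply co_cons; [|exact H]. now apply (frel_ck' O PZero).
  - destruct (Nat.eqb_spec d 0) as [Ed|]; [subst d|exact H].
    eapply co_cons; [|exact H]. now apply (frel_ck' O PSucc).
  - eapply co_cons; [|exact H]. now apply (frel_ck' O (PProj d)).
  - destruct (pair_surj d) as (f & gs & ->). autorewrite with un in H.
    co_inv H s. co_inv H s'. subst.
    eapply co_cons; [|exact H]. eapply frel_ck'. symmetry. apply code_prf_comp.
  - destruct (pair_surj d) as (f & h & ->). autorewrite with un in H.
    co_inv H s. co_inv H s'. subst.
    eapply co_cons; [|exact H]. now eapply (frel_ck' O (PRec _ _)).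
  - co_inv H s. subst.
    eapply co_cons; [|exact H]. now eapply (frel_ck' O (PMu _)).
  - destruct (Nat.eqb_spec d 0) as [Ed|]; [subst d|exact H].
    eapply co_cons; [|exact H]. now apply (frel_ck' O POracle).
  - exact H.
Qed.

Lemma complete_step O g st : ofun O g -> complete O (step g st) -> complete O st.
Proof.
  intros HO H. destruct (pair_surj st) as (r & K0 & ->).
  destruct (ncons_surj K0) as [->|(F & K & ->)]; [constructor|].
  destruct (pair_surj F) as (t & d & ->).
  unfold step, step_frame in H. cbv zeta in H. autorewrite with un in H.
  destruct t as [|[|[|[|[|[|[|t]]]]]]]; cbn [Nat.eqb orb] in H.
  - destruct (pair_surj d) as (c & v & ->). autorewrite with un in H.
    now apply complete_step_ev with g.
  - destruct (pair_surj d) as (d1 & d2 & ->). destruct (pair_surj d1) as (gs & acc & ->).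
    destruct (pair_surj d2) as (v & f & ->). autorewrite with un in H.
    change (complete O (pair r (ncons (fArgs gs acc v f) K))).
    destruct (ncons_surj gs) as [->|(x & xs & ->)]; autorewrite with un in H; cbn [Nat.eqb] in H.
    + destruct (lcode_surj acc) as [a ->]. destruct (lcode_surj v) as [u ->].
      rewrite nrev_lcode in H. co_inv H s. subst.
      match goal with E : lcode _ = lcode _ |- _ => apply lcode_inj in E; subst end.
      eapply co_cons; [|exact H]. apply (fr_args O [] _ _ _ []); [constructor|].
      now rewrite app_nil_r.
    + co_inv H s. co_inv H s'. subst.
      match goal with E : lcode _ = lcode _ |- _ => apply lcode_inj in E; subst end.
      eapply co_cons; [|exact H].
      match goal with |- frel _ (fArgs (ncons (code_prf ?c) (lcode (map code_prf ?cs))) _ _ _) _ _ =>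
        eapply (fr_args O (c :: cs)) end; [constructor; eassumption|]. assumption.
  - destruct (pair_surj d) as (d1 & d2 & ->). destruct (pair_surj d1) as (gs & acc & ->).
    destruct (pair_surj d2) as (v & f & ->). autorewrite with un in H.
    change (complete O (pair r (ncons (fArgK gs acc v f) K))).
    co_inv H s. subst.
    match goal with E : ncons r _ = lcode _ |- _ =>
      apply lcode_inv_cons in E as (u & -> & E); subst end.
    eapply co_cons; [|exact H]. eapply fr_argk; [eassumption|].
    match goal with E : eval _ _ (rev (r :: _) ++ _) _ |- _ =>
      simpl in E; rewrite <- app_assoc in E; exact E end.
  - destruct (pair_surj d) as (c & d1 & ->). destruct (pair_surj d1) as (n & w & ->).
    autorewrite with un in H. change (complete O (pair r (ncons (fRec c n w) K))).
    co_inv H s. subst.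
    match goal with E : ncons n _ = lcode _ |- _ =>
      apply lcode_inv_cons in E as (u & -> & E); apply lcode_inv_cons in E as (u' & -> & E);
      subst end.
    eapply co_cons; [|exact H]. now constructor.
  - destruct (pair_surj d) as (c & d1 & ->). destruct (pair_surj d1) as (v & n & ->).
    autorewrite with un in H. change (complete O (pair r (ncons (fMu c v n) K))).
    destruct r as [|r]; cbn [Nat.eqb] in H.
    + eapply co_cons; [|exact H]. constructor.
    + co_inv H s. co_inv H s'. subst.
      match goal with E : ncons _ _ = lcode _ |- _ =>
        apply lcode_inv_cons in E as (u & -> & ->) end.
      eapply co_cons; [|exact H].
      destruct F as [[-> ->]|(f' & v' & Ef & Ev & Hs & Hs' & F1 & F2)].
      * constructor; [lia|assumption|lia].
      * apply code_prf_inj in Ef. apply lcode_inj in Ev. subst.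
        constructor; [lia|assumption|]. intros m Hm.
        destruct (Nat.eq_dec m (S n)) as [->|]; [|apply F2; lia].
        destruct s as [|s]; [lia|]. eauto.
  - now apply complete_step_ck.
  - change (complete O (pair r (ncons (fCkL d) K))).
    destruct (ncons_surj d) as [->|(x & xs & ->)]; autorewrite with un in H; cbn [Nat.eqb] in H.
    + eapply co_cons; [|exact H]. apply (fr_ckl O []).
    + co_inv H s. co_inv H s'. subst.
      eapply co_cons; [|exact H].
      match goal with |- frel _ (fCkL (ncons (code_prf ?p) (lcode (map code_prf ?cs)))) _ _ =>
        apply (fr_ckl O (p :: cs)) end.
  - exact H.
Qed.

Definition init (c v : nat) : nat := pair 0 (ncons (fEv c v) 0).

Definition halts_by (g : nat -> nat) (s c v : nat) : bool :=
  usnd (run g s (init c v)) =? 0.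

Lemma complete_run O g n st : ofun O g -> complete O (run g n st) -> complete O st.
Proof.
  intro HO. revert st. induction n as [|n IH]; intros st; [auto|].
  simpl. intro H. apply IH. now apply complete_step with g.
Qed.

(** Here [c] is any number. A run can end only if [c] codes a program, which is what the [fCk] tasks
    are for and what [jump] demands of its elements. *)
Lemma halts_by_spec O g c v : ofun O g ->
  (exists s, halts_by g s c (lcode v) = true) <->
  (exists p y, c = code_prf p /\ eval O p v y).
Proof.
  intro HO. unfold halts_by, init. split.
  - intros [s H]. apply Nat.eqb_eq in H.
    assert (C : complete O (pair 0 (ncons (fEv c (lcode v)) 0))).
    { apply complete_run with g s; [exact HO|].
      rewrite <- (pair_eta (run _ _ _)), H. constructor. }
    apply complete_cons_inv in C as (y & C & _).
    apply frel_ev_inv in C as (p & u & -> & E & C). apply lcode_inj in E. subst. eauto.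
  - intros (p & y & -> & E).
    destruct (runs_eval O g p v y HO E 0 0) as [n H]. exists n.
    now rewrite H, usnd_pair.
Qed.

Lemma halts_by_le g s s' c v : s <= s' -> halts_by g s c v = true -> halts_by g s' c v = true.
Proof.
  unfold halts_by. intros Hs H. replace s' with ((s' - s) + s) by lia. rewrite run_add.
  induction (s' - s) as [|d IH]; [exact H|]. simpl. unfold step at 1. now rewrite IH.
Qed.

Lemma PRB_halts_by k g s c v : PR (S k) (fun w => g (hd 0 w) (tl w)) ->
  PR k s -> PR k c -> PR k v ->
  PRB k (fun w => halts_by (fun x => g x w) (s w) (c w) (v w)).
Proof.
  intros. unfold halts_by, init, fEv. apply PRB_eqb; [|pr]. apply PR_usnd.
  apply PR_run; pr.
Qed.

(** The use principle: a step makes at most one query, so a run of [n] steps depends on finitely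
    many oracle values. *)
Lemma run_continuous g n st : exists q, forall g',
  (forall x, x < q -> g' x = g x) -> run g' n st = run g n st.
Proof.
  induction n as [|n [q IH]]; [now exists 0|].
  (* The only number that the next step can query: the first argument of the task on top of the
     stack. *)
  set (x := nhd (usnd (usnd (nhd (usnd (run g n st)))))).
  exists (Nat.max q (S x)). intros g' H. simpl.
  rewrite IH by (intros; apply H; lia).
  unfold step, step_frame, step_ev. cbv zeta. fold x.
  now rewrite (H x) by lia.
Qed.

(** * The double jump as a limit of decidable approximations *)

Definition halting (t x : nat) : nat :=
  Nat.b2n (halts_by (fun _ => 0) t x (ncons x 0)).

(** Two separate clocks: [s] bounds the computation, [t] is the stage of the approximation to its
    oracle 0'. The value grows with [s], but in [t] it only converges. *)
Definition halts_rel (s e t : nat) : bool := halts_by (halting t) s e (ncons e 0).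

Lemma PRB_halts_rel k s e t : PR k s -> PR k e -> PR k t ->
  PRB k (fun v => halts_rel (s v) (e v) (t v)).
Proof.
  intros Hs He Ht. unfold halts_rel.
  apply (PRB_halts_by k (fun x v => halting (t v) x)); [|pr|pr|pr].
  apply (PRB_halts_by (S k) (fun _ _ => 0)); pr.
Qed.
#[global] Hint Resolve PRB_halts_rel : pr.

Definition char_jump (x : nat) : nat :=
  if excluded_middle_informative (jump empty_set x) then 1 else 0.

Lemma ofun_empty : ofun (graph_set empty_set) (fun _ => 0).
Proof. intros x y. unfold graph_set, empty_set. intuition. Qed.

Lemma ofun_char_jump : ofun (graph_set (jump empty_set)) char_jump.
Proof.
  intros x y. unfold graph_set, char_jump.
  destruct excluded_middle_informative; intuition.
Qed.

Lemma jump_halts P g x : ofun (graph_set P) g ->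
  jump P x <-> exists s, halts_by g s x (lcode [x]) = true.
Proof.
  intro HO. rewrite (halts_by_spec _ _ _ _ HO). unfold jump. firstorder.
Qed.

Lemma halting_limit q : exists t0, forall t x, t0 <= t -> x < q -> halting t x = char_jump x.
Proof.
  induction q as [|q [t1 IH]]; [exists 0; intros; lia|].
  assert (E : exists t2, forall t, t2 <= t -> halting t q = char_jump q).
  { pose proof (jump_halts _ _ q ofun_empty) as J.
    unfold char_jump, halting. destruct excluded_middle_informative as [Hq|Hq].
    - apply J in Hq as [t2 Ht]. exists t2. intros t Hle.
      change (ncons q 0) with (lcode [q]). now rewrite (halts_by_le _ t2 t).
    - exists 0. intros t _. change (ncons q 0) with (lcode [q]).
      destruct halts_by eqn:E; [|reflexivity]. destruct Hq. apply J. eauto. }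
  destruct E as [t2 E]. exists (Nat.max t1 t2). intros t x Ht Hx.
  destruct (Nat.eq_dec x q) as [->|]; [apply E | apply IH]; lia.
Qed.

(** The run with oracle 0' has a finite use, and below it the approximations to 0' are eventually
    correct. *)
Lemma halts_rel_limit s e : exists t0, forall t, t0 <= t ->
  halts_rel s e t = halts_by char_jump s e (ncons e 0).
Proof.
  unfold halts_rel, halts_by.
  destruct (run_continuous char_jump s (init e (ncons e 0))) as [q Hq].
  destruct (halting_limit q) as [t0 H]. exists t0. intros t Ht.
  now rewrite (Hq (halting t)) by auto.
Qed.

(* A decidable matrix exhibiting 0'' and its complement as Sigma_3 sets: [e] lies in
   0'' iff [forall n, exists m, witness e k n m] holds for some [k > 0], and outside
   0'' iff it holds for [k = 0]. *)
Definition witness (e k n m : nat) : bool :=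
  if k =? 0 then negb (halts_rel (ufst n) e (usnd n + m))
  else halts_rel (ufst (pred k)) e (usnd (pred k) + n).

(** [n] codes a step count and a stage, so the left side says that for each step count the run fails
    to halt at arbitrarily late stages. As the outcome settles with the stage, this is divergence
    relative to 0'. *)
Lemma witness_0 e : (forall n, exists m, witness e 0 n m = true) <-> ~ zero_jump2 e.
Proof.
  unfold zero_jump2. rewrite (jump_halts _ _ e ofun_char_jump). unfold witness. simpl. split.
  - intros H [s Hs]. destruct (halts_rel_limit s e) as [t0 Ht].
    destruct (H (pair s t0)) as [m Hm]. rewrite ufst_pair, usnd_pair in Hm.
    rewrite Ht in Hm by lia. simpl lcode in Hs. now rewrite Hs in Hm.
  - intros H n. destruct (halts_rel_limit (ufst n) e) as [t0 Ht]. exists t0.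
    rewrite Ht by lia. apply negb_true_iff, not_true_iff_false.
    intro E. apply H. now exists (ufst n).
Qed.

Lemma witness_S e k : (forall n, exists m, witness e (S k) n m = true) -> zero_jump2 e.
Proof.
  unfold zero_jump2. rewrite (jump_halts _ _ e ofun_char_jump). unfold witness. simpl.
  intro H. exists (ufst k). destruct (halts_rel_limit (ufst k) e) as [t0 Ht].
  destruct (H t0) as [_ Hn]. simpl lcode. now rewrite <- (Ht (usnd k + t0)) by lia.
Qed.

Lemma witness_ex e : exists k, forall n, exists m, witness e k n m = true.
Proof.
  destruct (classic (zero_jump2 e)) as [He|He]; [|exists 0; now apply witness_0].
  apply (jump_halts _ _ e ofun_char_jump) in He as [s Hs].
  (* [k] packs a halting time with a stage from which the outcome is final; the successor is there
     because 0 stands for the complement. *)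
  destruct (halts_rel_limit s e) as [t0 Ht]. exists (S (pair s t0)).
  intro n. exists 0. unfold witness. simpl. rewrite ufst_pair, usnd_pair, Ht by lia.
  exact Hs.
Qed.

Lemma PRB_witness k e i n m : PR k e -> PR k i -> PR k n -> PR k m ->
  PRB k (fun v => witness (e v) (i v) (n v) (m v)).
Proof.
  intros. apply PR_ext with (fun v => if i v =? 0
    then Nat.b2n (negb (halts_rel (ufst (n v)) (e v) (usnd (n v) + m v)))
    else Nat.b2n (halts_rel (ufst (pred (i v))) (e v) (usnd (pred (i v)) + n v))).
  - intro v. unfold witness. now destruct (i v =? 0).
  - assert (W : forall p, PRB k p -> PR k (fun v => Nat.b2n (p v))) by auto.
    apply PR_if; [pr | |]; apply W; pr.
Qed.
#[global] Hint Resolve PRB_witness : pr.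

(** * Enumerability by unbounded search *)

Lemma eval_functional O g c v y y' : ofun O g ->
  eval O c v y -> eval O c v y' -> y = y'.
Proof.
  intros HO H H'.
  destruct (runs_eval O g c v y HO H 0 0) as [n E].
  destruct (runs_eval O g c v y' HO H' 0 0) as [n' E'].
  (* A state with empty stack is a fixed point, so the longer of the two deterministic runs ends
     where the shorter one did. *)
  assert (F : forall d z, run g d (pair z 0) = pair z 0).
  { intros d z. induction d as [|d IH]; [reflexivity|]. simpl. rewrite IH.
    unfold step. now rewrite usnd_pair. }
  destruct (Nat.le_ge_cases n n') as [L|L]; [|symmetry in E, E'].
  - replace n' with ((n' - n) + n) in E' by lia. rewrite run_add, E, F in E'.
    now apply pair_inj in E'.
  - replace n with ((n - n') + n') in E by lia. rewrite run_add, <- E', F in E.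
    now apply pair_inj in E.
Qed.

Lemma ce2_intro (q : nat -> nat -> nat -> bool) :
  PRB 3 (fun v => q (hd 0 v) (hd 0 (tl v)) (hd 0 (tl (tl v)))) ->
  ce2 (fun a b => exists m, q m a b = true).
Proof.
  intro Hq. apply PRB_negb in Hq as [c Hc]. exists (PMu c). intros a b.
  assert (E : forall m, eval (graph_set empty_set) c [m; a; b] (Nat.b2n (negb (q m a b))))
    by (intro; now apply Hc).
  split.
  - intros [m Hm].
    assert (M : exists n, q n a b = true /\ forall k, k < n -> q k a b = false).
    { induction m as [m IH] using (well_founded_induction lt_wf).
      destruct (classic (exists k, k < m /\ q k a b = true)) as [(k & H1 & H2)|N]; [eauto|].
      exists m. split; [exact Hm|]. intros k Hk. apply not_true_iff_false.
      intro H. apply N. eauto. }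
    destruct M as (n & H1 & H2). exists n. constructor.
    + specialize (E n). now rewrite H1 in E.
    + intros k Hk. exists 0. specialize (E k). now rewrite H2 in E.
  - intros [m Hm]. exists m. inversion Hm; subst.
    assert (H : 0 = Nat.b2n (negb (q m a b)))
      by (eapply eval_functional; [exact ofun_empty | eassumption | apply E]).
    destruct (q m a b); [reflexivity | discriminate H].
Qed.

(** * Finite levels of Cantor space *)

(** Bit strings are read as numbers, least significant bit first. *)
Fixpoint res (X : cantor) (s : nat) : nat :=
  match s with 0 => 0 | S s' => res X s' + Nat.b2n (X s') * 2 ^ s' end.

Lemma mod_pow2_succ x s : x mod 2 ^ S s = x mod 2 ^ s + Nat.b2n (Nat.testbit x s) * 2 ^ s.
Proof.
  rewrite Nat.pow_succ_r', (Nat.mul_comm 2), Nat.Div0.mod_mul_r, Nat.testbit_spec'. lia.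
Qed.

Lemma mod_mod_pow2 x l s : l <= s -> (x mod 2 ^ s) mod 2 ^ l = x mod 2 ^ l.
Proof.
  intro H. replace s with (l + (s - l)) by lia.
  rewrite Nat.pow_add_r, Nat.Div0.mod_mul_r, Nat.Div0.add_mod, (Nat.mul_comm (2 ^ l)).
  rewrite Nat.Div0.mod_mul, Nat.add_0_r. now rewrite !Nat.Div0.mod_mod.
Qed.

Lemma res_testbit X x s : (forall k, k < s -> X k = Nat.testbit x k) -> res X s = x mod 2 ^ s.
Proof.
  induction s as [|s IH]; intro H; [now rewrite Nat.mod_1_r|].
  rewrite mod_pow2_succ. simpl res. rewrite IH by auto. now rewrite H by lia.
Qed.

Lemma res_lt X s : res X s < 2 ^ s.
Proof. induction s; simpl; [lia|]. destruct (X s); simpl; lia. Qed.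

Lemma res_mod X l s : l <= s -> res X s mod 2 ^ l = res X l.
Proof.
  intro H. induction s as [|s IH].
  - replace l with 0 by lia. reflexivity.
  - destruct (Nat.eq_dec l (S s)) as [->|].
    { apply Nat.mod_small, res_lt. }
    rewrite <- IH by lia. simpl res.
    assert (E : 2 ^ s = 2 ^ (s - l) * 2 ^ l) by (rewrite <- Nat.pow_add_r; f_equal; lia).
    now rewrite E, Nat.mul_assoc, Nat.Div0.mod_add.
Qed.

Fixpoint snum (s : str) : nat :=
  match s with [] => 0 | b :: s' => 2 * snum s' + Nat.b2n b end.

Lemma snum_lt s : snum s < 2 ^ length s.
Proof. induction s as [|[|] s IH]; simpl; lia. Qed.

Lemma code_str_snum s : S (code_str s) = 2 ^ length s + snum s.
Proof. induction s as [|[|] s IH]; simpl in *; lia. Qed.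

Lemma snum_ex l x : x < 2 ^ l -> exists s, length s = l /\ snum s = x.
Proof.
  revert x. induction l as [|l IH]; intros x H; [exists []; simpl in *; split; lia|].
  destruct (IH (x / 2)) as (s & H1 & H2).
  { apply Nat.Div0.div_lt_upper_bound. simpl in H. lia. }
  exists (Nat.odd x :: s). simpl. split; [congruence|]. rewrite H2.
  pose proof (Nat.div2_odd x) as E. rewrite Nat.div2_div in E. lia.
Qed.

Lemma res_shift X s : res X (S s) = Nat.b2n (X 0) + 2 * res (fun k => X (S k)) s.
Proof. induction s as [|s IH]; [simpl; lia|]. simpl in *. lia. Qed.

Lemma prefix_res s X : prefix s X <-> res X (length s) = snum s.
Proof.
  unfold prefix. revert X. induction s as [|b s IH]; intro X.
  - simpl. split; [reflexivity|]. intros _ k Hk. lia.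
  - simpl length. rewrite res_shift. simpl snum. split.
    + intro H. rewrite (proj1 (IH (fun k => X (S k)))).
      * rewrite <- (H 0) by lia. simpl. lia.
      * intros k Hk. apply (H (S k)). lia.
    + intro H.
      assert (E : X 0 = b /\ res (fun k => X (S k)) (length s) = snum s)
        by (destruct (X 0), b; simpl in H; split; try reflexivity; lia).
      destruct E as [E0 E]. intros [|k] Hk; simpl; [congruence|].
      apply (proj2 (IH (fun k => X (S k))) E). lia.
Qed.

(** An effectively open set is presented by a monotone sequence [u] of clopen sets,
    [u s] being a set of bit strings of length [s], encoded as numbers below [2 ^ s]. *)
Definition lev (u : nat -> nat -> bool) : cantor -> Prop :=
  fun X => exists s, u s (res X s) = true.

Definition mono (u : nat -> nat -> bool) : Prop :=
  forall s t x, s <= t -> u s (x mod 2 ^ s) = true -> u t x = true.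

(** Compactness in the form of Koenig's lemma: if no level covers the cylinder, the strings having
    uncovered extensions at all levels form a tree without dead ends, and a branch of it is a point
    outside [lev u]. *)
Lemma lev_compact u l y : mono u -> (forall X, res X l = y -> lev u X) ->
  exists m, l <= m /\ forall x, x < 2 ^ m -> x mod 2 ^ l = y -> u m x = true.
Proof.
  intros Hu H. apply NNPP. intro N.
  set (ext := fun l y => forall m, l <= m ->
                exists x, x < 2 ^ m /\ x mod 2 ^ l = y /\ u m x = false).
  assert (E0 : ext l y).
  { intros m Hm. apply NNPP. intro C. apply N. exists m. split; [exact Hm|].
    intros x H1 H2. apply not_false_iff_true. intro. apply C. eauto. }
  assert (Es : forall l y, ext l y -> exists z, z mod 2 ^ l = y /\ ext (S l) z).
  { clear -Hu. intros l y E.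
    (* A child that is not extendible is covered from some level on; if both children were, their
       parent would be covered at a common later level. *)
    assert (A : forall z, z < 2 ^ S l -> z mod 2 ^ l = y -> ~ ext (S l) z ->
      exists m0, forall m x, m0 <= m -> x < 2 ^ m -> x mod 2 ^ S l = z -> u m x = true).
    { intros z _ _ Hz. apply not_all_ex_not in Hz as [m0 Hz]. exists (Nat.max m0 (S l)).
      intros m x Hm Hx Hxz. apply not_false_iff_true. intro F. apply Hz. intros Hm0.
      exists (x mod 2 ^ m0). repeat split.
      - apply Nat.mod_upper_bound, Nat.pow_nonzero. lia.
      - now rewrite mod_mod_pow2.
      - apply not_true_iff_false. intro T. rewrite (Hu m0 m x) in F; [easy|lia|easy]. }
    destruct (E l (le_n l)) as (y0 & Hy0 & Hy & _).
    rewrite Nat.mod_small in Hy by exact Hy0. subst y0.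
    assert (Hy1 : (y + 2 ^ l) mod 2 ^ l = y).
    { rewrite Nat.Div0.add_mod, Nat.Div0.mod_same, Nat.add_0_r.
      rewrite Nat.Div0.mod_mod. now apply Nat.mod_small. }
    destruct (classic (ext (S l) y)) as [|N0];
      [exists y; split; [now apply Nat.mod_small | assumption]|].
    destruct (classic (ext (S l) (y + 2 ^ l))) as [|N1]; [now exists (y + 2 ^ l)|].
    apply A in N0 as [m0 N0]; [|simpl; lia|now apply Nat.mod_small].
    apply A in N1 as [m1 N1]; [|simpl; lia|exact Hy1].
    destruct (E (Nat.max (S l) (Nat.max m0 m1))) as (x & H1 & H2 & H3); [lia|].
    pose proof (mod_pow2_succ x l) as Hx. rewrite H2 in Hx.
    destruct (Nat.testbit x l); simpl in Hx.
    - rewrite N1 in H3; [easy|lia|easy|simpl; lia].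
    - rewrite N0 in H3; [easy|lia|easy|simpl; lia]. }
  set (next := fun (n : nat) (z : {z | ext (l + n) z}) =>
    constructive_indefinite_description _ (Es (l + n) (proj1_sig z) (proj2_sig z))).
  assert (Hn : forall n, S (l + n) = l + S n) by (intro; lia).
  set (f := fix f (n : nat) : {z | ext (l + n) z} :=
    match n with
    | 0 => exist _ y (eq_ind_r (fun k => ext k y) E0 (Nat.add_0_r l))
    | S n' => let d := next n' (f n') in
              exist _ (proj1_sig d)
                (eq_ind _ (fun k => ext k (proj1_sig d)) (proj2 (proj2_sig d)) _ (Hn n'))
    end).
  set (p := fun n => proj1_sig (f n)).
  assert (Hp : forall n, p (S n) mod 2 ^ (l + n) = p n)
    by (intro n; apply (proj1 (proj2_sig (next n (f n))))).
  assert (He : forall n, ext (l + n) (p n)) by (intro n; apply (proj2_sig (f n))).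
  assert (Hl : forall n, p n < 2 ^ (l + n)).
  { intro n. destruct (He n (l + n) (le_n _)) as (x & H1 & H2 & _).
    now rewrite Nat.mod_small in H2 by exact H1; subst. }
  assert (Hc : forall n d, p (n + d) mod 2 ^ (l + n) = p n).
  { intros n d. induction d as [|d IH].
    - rewrite Nat.add_0_r. now apply Nat.mod_small.
    - rewrite Nat.add_succ_r, <- IH, <- (Hp (n + d)). symmetry. apply mod_mod_pow2. lia. }
  (* Bit [k] is settled in [p (S k)], whose length [l + S k] exceeds [k]. *)
  set (X := fun k => Nat.testbit (p (S k)) k).
  assert (HX : forall n, res X (l + n) = p n).
  { intro n. rewrite (res_testbit _ (p n)); [now apply Nat.mod_small|].
    intros k Hk. unfold X. destruct (Nat.le_ge_cases (S k) n) as [L|L].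
    - replace n with (S k + (n - S k)) by lia. rewrite <- (Hc (S k) (n - S k)).
      apply Nat.mod_pow2_bits_low. lia.
    - rewrite <- (Hc n (S k - n)). replace (n + (S k - n)) with (S k) by lia.
      symmetry. apply Nat.mod_pow2_bits_low. lia. }
  destruct (H X) as [s Hs].
  { rewrite <- (Nat.add_0_r l). now rewrite HX. }
  destruct (He s (l + s) (le_n _)) as (x & H1 & H2 & H3).
  rewrite Nat.mod_small in H2 by exact H1. subst x.
  rewrite (Hu s (l + s) (p s)) in H3; [easy|lia|].
  now rewrite <- HX, res_mod by lia.
Qed.

(** Turns a statement about all points of a cylinder into a search over finite levels, which makes
    the inclusion enumerable. *)
Lemma cyl_sub_lev u s : mono u -> cyl_sub s (lev u) <->
  exists m, length s <= m /\
    forall x, x < 2 ^ m -> x mod 2 ^ length s = snum s -> u m x = true.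
Proof.
  intro Hu. unfold cyl_sub. split.
  - intro H. apply lev_compact; [exact Hu|]. intros X HX. apply H. now apply prefix_res.
  - intros (m & Hm & H) X HX. apply prefix_res in HX. exists m.
    apply H; [apply res_lt | now rewrite res_mod].
Qed.

Lemma lev_open u : mono u -> open_set (lev u).
Proof.
  intros Hu X [s Hs]. destruct (snum_ex s (res X s) (res_lt X s)) as (t & Hl & Ht).
  exists t. rewrite prefix_res, Hl. split; [now symmetry|].
  intros Y HY. rewrite prefix_res, Hl, Ht in HY. exists s. now rewrite HY.
Qed.

Lemma lev_unif_eff_open (u : nat -> nat -> nat -> bool) :
  (forall i, mono (u i)) ->
  (forall k a s x, PR k a -> PR k s -> PR k x ->
    PRB k (fun v => u (a v) (s v) (x v))) ->
  unif_eff_open (fun i => lev (u i)).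
Proof.
  intros Hu Hp. split; [intro; now apply lev_open|].
  (* By [code_str_snum] the successor of a string's code is [2 ^ l] plus its numerical value. The
     length [l] is thus fixed by [2 ^ l <= S n < 2 ^ S l], and the value is [S n - 2 ^ l]. *)
  destruct (ce2_intro (fun m a n => bex (S n) (fun l =>
      (2 ^ l <=? S n) && (S (S n) <=? 2 ^ S l) && (l <=? m) &&
      ball (2 ^ m) (fun x => negb (x mod 2 ^ l =? S n - 2 ^ l) || u a m x)))) as [c Hc];
    [pr|].
  exists c. intros a n. rewrite <- Hc. clear Hc. split.
  - intros (s & -> & H). apply cyl_sub_lev in H as (m & Hm & H); [|apply Hu].
    exists m. apply bex_true. exists (length s). pose proof (code_str_snum s) as E.
    pose proof (snum_lt s). pose proof (Nat.pow_gt_lin_r 2 (length s)).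
    split; [lia|]. rewrite !andb_true_iff, !Nat.leb_le, ball_true. simpl Nat.pow.
    repeat split; try lia. intros x Hx.
    destruct (Nat.eqb_spec (x mod 2 ^ length s) (S (code_str s) - 2 ^ length s)) as [e|];
      [|reflexivity].
    simpl. apply H; [exact Hx | lia].
  - intros [m H]. apply bex_true in H as (l & Hl & H).
    rewrite !andb_true_iff, !Nat.leb_le, ball_true in H. simpl Nat.pow in H.
    destruct H as (((H1 & H2) & H3) & H4).
    destruct (snum_ex l (S n - 2 ^ l)) as (s & <- & Hs); [lia|].
    pose proof (code_str_snum s) as E. exists s. split; [lia|].
    apply cyl_sub_lev; [apply Hu|]. exists m. split; [exact H3|]. intros x Hx Hxs.
    specialize (H4 x Hx). rewrite Hs in Hxs. now rewrite Hxs, Nat.eqb_refl in H4.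
Qed.

(** * Measure as a count of strings of one length *)

Definition cnt (s : nat) (p : nat -> bool) : nat := bsum (2 ^ s) (fun x => Nat.b2n (p x)).

Lemma bsum_le n f g : (forall x, x < n -> f x <= g x) -> bsum n f <= bsum n g.
Proof.
  intro H. induction n as [|n IH]; simpl; [lia|].
  pose proof (H n). assert (bsum n f <= bsum n g) by auto. lia.
Qed.

Lemma bsum_add n f g : bsum n (fun x => f x + g x) = bsum n f + bsum n g.
Proof. induction n; simpl; lia. Qed.

Lemma bsum_split n m f : bsum (n + m) f = bsum n f + bsum m (fun x => f (n + x)).
Proof.
  rewrite Nat.add_comm. induction m as [|m IH]; simpl; [lia|].
  rewrite IH, (Nat.add_comm m n). lia.
Qed.

Lemma bsum_eqb n y : bsum n (fun x => Nat.b2n (x =? y)) <= 1.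
Proof.
  assert (H : y < n \/ n <= y -> bsum n (fun x => Nat.b2n (x =? y)) = Nat.b2n (y <? n)).
  { intros _. induction n as [|n IH]; [reflexivity|]. cbn [bsum]. rewrite IH.
    destruct (Nat.eqb_spec n y), (Nat.ltb_spec y n), (Nat.ltb_spec y (S n));
      simpl; lia. }
  rewrite H by lia. destruct (y <? n); simpl; lia.
Qed.

Lemma PR_cnt k s p : PR k s -> PRB (S k) (fun w => p (hd 0 w) (tl w)) ->
  PR k (fun v => cnt (s v) (fun x => p x v)).
Proof. intros. unfold cnt. apply (PR_bsum k (fun x v => Nat.b2n (p x v))); pr. Qed.
#[global] Hint Resolve PR_cnt : pr.

Lemma cnt_le s p q : (forall x, x < 2 ^ s -> p x = true -> q x = true) -> cnt s p <= cnt s q.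
Proof.
  intro H. apply bsum_le. intros x Hx. specialize (H x Hx).
  destruct (p x), (q x); simpl; auto. now discriminate H.
Qed.

Lemma cnt_or s p q : cnt s (fun x => p x || q x) <= cnt s p + cnt s q.
Proof.
  unfold cnt. rewrite <- bsum_add. apply bsum_le. intros x _.
  destruct (p x), (q x); simpl; lia.
Qed.

Lemma cnt_bex s n p : cnt s (fun x => bex n (fun e => p e x)) <= bsum n (fun e => cnt s (p e)).
Proof.
  induction n as [|n IH]; simpl.
  - unfold cnt. induction (2 ^ s); simpl in *; lia.
  - etransitivity; [apply cnt_or|].
    apply Nat.add_le_mono; [reflexivity | exact IH].
Qed.

(** The low bits come first, so [x mod 2 ^ s] is the prefix of length [s], and each prefix has
    [2 ^ d] extensions: the measure does not depend on the level at which it is counted. *)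
Lemma cnt_mod s d p : cnt (d + s) (fun x => p (x mod 2 ^ s)) = 2 ^ d * cnt s p.
Proof.
  induction d as [|d IH]; unfold cnt in *.
  - simpl. rewrite Nat.add_0_r.
    assert (H : forall n, n <= 2 ^ s ->
      bsum n (fun x => Nat.b2n (p (x mod 2 ^ s))) = bsum n (fun x => Nat.b2n (p x))).
    { induction n as [|n IHn]; intro Hn; [reflexivity|]. cbn [bsum].
      rewrite IHn by lia. now rewrite Nat.mod_small by lia. }
    now apply H.
  - simpl Nat.add. rewrite Nat.pow_succ_r'. simpl Nat.mul. rewrite Nat.add_0_r, bsum_split.
    assert (H : forall n, bsum n (fun x => Nat.b2n (p ((2 ^ (d + s) + x) mod 2 ^ s))) =
      bsum n (fun x => Nat.b2n (p (x mod 2 ^ s)))).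
    { induction n as [|n IHn]; [reflexivity|]. cbn [bsum]. rewrite IHn. do 3 f_equal.
      rewrite Nat.pow_add_r, (Nat.add_comm (_ * _)). apply Nat.Div0.mod_add. }
    rewrite H, IH. simpl. lia.
Qed.

Lemma cnt_cyl l s y : l <= s -> cnt s (fun x => x mod 2 ^ l =? y) <= 2 ^ (s - l).
Proof.
  intro H. replace s with ((s - l) + l) at 1 by lia.
  rewrite (cnt_mod l (s - l) (fun x => x =? y)).
  pose proof (bsum_eqb (2 ^ l) y). unfold cnt. nia.
Qed.

(** [all_strs] adds bits at the front, the least significant place, so each [x] gives way to [2 * x]
    and [2 * x + 1] and the order stays increasing. *)
Lemma snum_all_strs n : map snum (all_strs n) = seq 0 (2 ^ n).
Proof.
  induction n as [|n IH]; [reflexivity|]. simpl all_strs.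
  rewrite flat_map_concat_map, concat_map, map_map.
  transitivity (flat_map (fun x => [2 * x; 2 * x + 1]) (map snum (all_strs n))).
  - rewrite flat_map_concat_map, map_map. f_equal. apply map_ext. intro s. simpl.
    now rewrite !Nat.add_0_r.
  - rewrite IH, Nat.pow_succ_r'. generalize (2 ^ n) as m. intro m. clear.
    assert (H : forall b, flat_map (fun x => [2 * x; 2 * x + 1]) (seq b m) = seq (2 * b) (2 * m)).
    { induction m as [|m IH]; intro b; [reflexivity|].
      replace (2 * S m) with (S (S (2 * m))) by lia. cbn [seq flat_map app].
      rewrite IH. replace (2 * b + 1) with (S (2 * b)) by lia.
      now replace (2 * S b) with (S (S (2 * b))) by lia. }
    apply (H 0).
Qed.

Lemma all_strs_length n t : In t (all_strs n) -> length t = n.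
Proof.
  revert t. induction n as [|n IH]; simpl.
  - intros t [<-|[]]. reflexivity.
  - intros t H. apply in_flat_map in H as (u & Hu & [<-|[<-|[]]]); simpl; now rewrite (IH u).
Qed.

Lemma is_prefix_snum s t : length s <= length t ->
  is_prefix_str s t = (snum t mod 2 ^ length s =? snum s).
Proof.
  revert t. induction s as [|a s IH]; intros [|b t] H; simpl in H; try lia.
  - reflexivity.
  - reflexivity.
  - simpl is_prefix_str. rewrite IH by lia. simpl length. simpl snum.
    rewrite Nat.pow_succ_r', Nat.Div0.mod_mul_r.
    rewrite (Nat.add_comm (2 * snum t)), (Nat.mul_comm 2 (snum t)), Nat.Div0.mod_add.
    rewrite Nat.div_add by lia. rewrite (Nat.div_small (Nat.b2n b)) by (destruct b; simpl; lia).
    rewrite (Nat.mod_small (Nat.b2n b)) by (destruct b; simpl; lia). simpl (0 + _).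
    generalize (snum t mod 2 ^ length s) as m. intro m.
    match goal with |- _ = (?p =? ?q) => destruct (Nat.eqb_spec p q) end;
      destruct (Nat.eqb_spec m (snum s)); destruct a, b; simpl in *; auto; lia.
Qed.

Definition in_cyls (L : list str) (x : nat) : bool :=
  existsb (fun s => x mod 2 ^ length s =? snum s) L.

Lemma length_filter_seq p n : length (filter p (seq 0 n)) = bsum n (fun x => Nat.b2n (p x)).
Proof.
  induction n as [|n IH]; [reflexivity|].
  rewrite seq_S, filter_app, length_app, IH. simpl. destruct (p n); simpl; lia.
Qed.

Lemma max_len_ge L s : In s L -> length s <= max_len L.
Proof.
  induction L as [|t L IH]; intro H; [easy|].
  change (max_len (t :: L)) with (Nat.max (length t) (max_len L)).
  destruct H as [->|H]; [lia|]. specialize (IH H). lia.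
Qed.

Lemma count_cyl_cnt n L : (forall s, In s L -> length s <= n) ->
  count_cyl n L = cnt n (in_cyls L).
Proof.
  intro HL. unfold count_cyl, cnt. rewrite <- length_filter_seq, <- snum_all_strs.
  rewrite filter_map_swap, length_map. f_equal. apply filter_ext_in. intros t Ht.
  apply all_strs_length in Ht. unfold in_cyls.
  induction L as [|s L IH]; [reflexivity|]. simpl.
  rewrite IH by (intros; apply HL; now right).
  now rewrite is_prefix_snum by (rewrite Ht; apply HL; now left).
Qed.

(** By compactness finitely many cylinders inside [lev u] are covered at one common level, where the
    bound is a count. *)
Lemma lev_measure u i : mono u -> (forall s, cnt s (u s) * 2 ^ i <= 2 ^ s) ->
  measure_le_pow2 (lev u) i.
Proof.
  intros Hu Hm L HL.
  assert (M : exists m, max_len L <= m /\ forall s, In s L ->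
    forall x, x < 2 ^ m -> x mod 2 ^ length s = snum s -> u m x = true).
  { pose proof (max_len_ge L) as Hge. revert HL Hge. generalize (max_len L) as M. intros M HL.
    induction HL as [|s L Hs _ IH]; intro Hge; [exists M; split; [lia|easy]|].
    destruct IH as (m1 & H1 & H1'); [intros; apply Hge; now right|].
    apply cyl_sub_lev in Hs as (m2 & H2 & H2'); [|exact Hu].
    exists (Nat.max m1 m2). split; [lia|].
    assert (T : forall m t, m <= Nat.max m1 m2 -> length t <= m ->
      (forall x, x < 2 ^ m -> x mod 2 ^ length t = snum t -> u m x = true) ->
      forall x, x < 2 ^ Nat.max m1 m2 -> x mod 2 ^ length t = snum t ->
      u (Nat.max m1 m2) x = true).
    { intros m t Hm' Ht H x Hx Hxt. apply (Hu m); [exact Hm'|]. apply H.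
      - apply Nat.mod_upper_bound, Nat.pow_nonzero. lia.
      - now rewrite mod_mod_pow2. }
    intros t [<-|Ht].
    - now apply (T m2); [lia| |].
    - apply (T m1); [lia| |now apply H1']. specialize (Hge t (or_intror Ht)). lia. }
  destruct M as (m & Hle & H).
  rewrite count_cyl_cnt by apply max_len_ge. set (M := max_len L) in *.
  assert (C : 2 ^ (m - M) * cnt M (in_cyls L) <= cnt m (u m)).
  { rewrite <- cnt_mod. replace (m - M + M) with m by lia. apply cnt_le.
    intros x Hx E. apply existsb_exists in E as (s & Hs & E). apply Nat.eqb_eq in E.
    pose proof (max_len_ge L s Hs). rewrite mod_mod_pow2 in E by easy. now apply (H s). }
  specialize (Hm m). apply (Nat.mul_le_mono_pos_l _ _ (2 ^ (m - M))).
  - pose proof (Nat.pow_nonzero 2 (m - M)). lia.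
  - rewrite <- Nat.pow_add_r. replace (m - M + M) with m by lia. nia.
Qed.

Lemma ML_test_lev (u : nat -> nat -> nat -> bool) :
  (forall i, mono (u i)) ->
  (forall k a s x, PR k a -> PR k s -> PR k x ->
    PRB k (fun v => u (a v) (s v) (x v))) ->
  (forall i s, cnt s (u i s) * 2 ^ i <= 2 ^ s) ->
  ML_test (fun i => lev (u i)).
Proof.
  intros H1 H2 H3. split; [now apply lev_unif_eff_open|].
  intro i. now apply lev_measure.
Qed.

(** The summand [M] on the left records a strict inequality, which later guarantees that a fresh
    cylinder exists. *)
Lemma geometric_bound n c M : (forall e, e < n -> c e * 2 ^ S e <= M) ->
  bsum n c * 2 ^ n + M <= M * 2 ^ n.
Proof.
  intro H. induction n as [|n IH]; simpl bsum; [simpl; lia|].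
  pose proof (H n (Nat.lt_succ_diag_r n)). rewrite Nat.pow_succ_r' in *.
  assert (bsum n c * 2 ^ n + M <= M * 2 ^ n) by auto. lia.
Qed.

Lemma geometric_le n c M : (forall e, e < n -> c e * 2 ^ S e <= M) -> bsum n c <= M.
Proof.
  intro H. apply geometric_bound in H. pose proof (Nat.pow_nonzero 2 n).
  apply (Nat.mul_le_mono_pos_r _ _ (2 ^ n)); lia.
Qed.

Lemma bsum_mul_r n c M : bsum n (fun e => c e * M) = bsum n c * M.
Proof. induction n; simpl; lia. Qed.

Lemma cnt_bex_geometric s n p i : (forall e, e < n -> cnt s (p e) * 2 ^ (i + S e) <= 2 ^ s) ->
  cnt s (fun x => bex n (fun e => p e x)) * 2 ^ i <= 2 ^ s.
Proof.
  intro H. transitivity (bsum n (fun e => cnt s (p e)) * 2 ^ i).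
  - apply Nat.mul_le_mono_r, cnt_bex.
  - rewrite <- bsum_mul_r. apply geometric_le. intros e He. specialize (H e He).
    rewrite Nat.pow_add_r in H. lia.
Qed.

Lemma bex_mono n m p q : n <= m -> (forall k, k < n -> p k = true -> q k = true) ->
  bex n p = true -> bex m q = true.
Proof.
  intros Hn H E. apply bex_true in E as (k & Hk & E). apply bex_true.
  exists k. split; [lia | auto].
Qed.

Lemma mod_pow2_lt x s : x mod 2 ^ s < 2 ^ s.
Proof. apply Nat.mod_upper_bound, Nat.pow_nonzero. lia. Qed.

(** * A universal test *)

(** The strings of length [s] having a prefix that program [e] puts into the [n]-th
    component within [s] steps; [pred (2 ^ l + y)] is the code of the string [y] of
    length [l]. *)
Definition enum (e n s x : nat) : bool :=
  bex (S s) (fun l =>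
    halts_by (fun _ => 0) s e (lcode [n; pred (2 ^ l + x mod 2 ^ l)])).

(* Enumeration is followed only while the measure stays at most [2 ^ -n]. *)
Definition trim (e n s x : nat) : bool :=
  bex (S s) (fun t => enum e n t (x mod 2 ^ t) && (cnt t (enum e n t) * 2 ^ n <=? 2 ^ t)).

(** Program [e] contributes its component [i + e + 2], so the total is at most 2^-(i+1), half of
    what a test allows. The spare half leaves room for the cylinders and for the other parts of
    [wtest]. *)
Definition univ (i s x : nat) : bool := bex s (fun e => trim e (i + S (S e)) s x).

Lemma PRB_enum k e n s x : PR k e -> PR k n -> PR k s -> PR k x ->
  PRB k (fun v => enum (e v) (n v) (s v) (x v)).
Proof.
  intros. unfold enum, lcode, fold_right. apply PRB_bex; [pr|].
  apply (PRB_halts_by (S k) (fun _ _ => 0)); pr.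
Qed.
#[global] Hint Resolve PRB_enum : pr.

Lemma PRB_trim k e n s x : PR k e -> PR k n -> PR k s -> PR k x ->
  PRB k (fun v => trim (e v) (n v) (s v) (x v)).
Proof.
  intros. unfold trim. apply PRB_bex; [pr|]. apply PRB_andb; [pr|].
  apply PRB_leb; [|pr]. apply PR_mul; [|pr].
  apply (PR_cnt (S k) (hd 0) (fun y w => enum (e (tl w)) (n (tl w)) (hd 0 w) y)); pr.
Qed.
#[global] Hint Resolve PRB_trim : pr.

Lemma PRB_univ k i s x : PR k i -> PR k s -> PR k x ->
  PRB k (fun v => univ (i v) (s v) (x v)).
Proof. intros. unfold univ. pr. Qed.
#[global] Hint Resolve PRB_univ : pr.

Lemma enum_mono e n : mono (enum e n).
Proof.
  intros s t x Hs. apply bex_mono; [lia|]. intros l Hl.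
  rewrite mod_mod_pow2 by lia. now apply halts_by_le.
Qed.

Lemma trim_mono e n : mono (trim e n).
Proof.
  intros s t x Hs. apply bex_mono; [lia|]. intros l Hl. now rewrite mod_mod_pow2 by lia.
Qed.

Lemma univ_mono i : mono (univ i).
Proof. intros s t x Hs. apply bex_mono; [lia|]. intros e _. now apply trim_mono. Qed.

Lemma trim_measure e n s : cnt s (trim e n s) * 2 ^ n <= 2 ^ s.
Proof.
  unfold trim.
  assert (H : forall m, m <= S s -> cnt s (fun x => bex m (fun t =>
    enum e n t (x mod 2 ^ t) && (cnt t (enum e n t) * 2 ^ n <=? 2 ^ t))) * 2 ^ n <= 2 ^ s).
  { induction m as [|m IH]; intro Hm.
    - replace (cnt _ _) with 0; [simpl; lia|]. unfold cnt.
      induction (2 ^ s); simpl in *; lia.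
    (* If stage [m] passes the test, all earlier stages lie inside it by monotonicity. Otherwise it
       adds nothing, and the bound for fewer stages applies. *)
    - destruct (Nat.leb_spec (cnt m (enum e n m) * 2 ^ n) (2 ^ m)) as [L|L].
      + transitivity (cnt s (fun x => enum e n m (x mod 2 ^ m)) * 2 ^ n).
        * apply Nat.mul_le_mono_r, cnt_le. intros x _ H.
          apply bex_true in H as (t & Ht & H). apply andb_true_iff in H as [H _].
          apply (enum_mono e n t m); [lia|]. now rewrite mod_mod_pow2 by lia.
        * replace s with ((s - m) + m) by lia. rewrite cnt_mod, Nat.pow_add_r.
          rewrite <- Nat.mul_assoc. now apply Nat.mul_le_mono_l.
      + transitivity (cnt s (fun x => bex m (fun t =>
          enum e n t (x mod 2 ^ t) && (cnt t (enum e n t) * 2 ^ n <=? 2 ^ t))) * 2 ^ n);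
          [|apply IH; lia].
        apply Nat.mul_le_mono_r, cnt_le. intros x _. simpl bex.
        apply Nat.leb_gt in L. rewrite L, andb_false_r. now intro. }
  now apply H.
Qed.

Lemma univ_measure i s : cnt s (univ i s) * 2 ^ S i <= 2 ^ s.
Proof.
  apply cnt_bex_geometric. intros e _.
  replace (S i + S e) with (i + S (S e)) by lia. apply trim_measure.
Qed.

Lemma univ_universal V : ML_test V -> forall X, (forall n, V n X) -> forall i, lev (univ i) X.
Proof.
  intros [[Ho [c Hc]] Hm] X HX i. set (e := code_prf c).
  assert (HT : forall n m, (exists s, halts_by (fun _ => 0) s e (lcode [n; m]) = true) <->
    exists s, m = code_str s /\ cyl_sub s (V n)).
  { intros n m. rewrite (halts_by_spec _ _ _ _ ofun_empty), Hc. split.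
    - intros (p & y & E & H). apply code_prf_inj in E. subst p. eauto.
    - intros [y H]. exists c, y. auto. }
  assert (HE : forall n s x, enum e n s x = true -> exists t, length t <= s /\
    snum t = x mod 2 ^ length t /\ cyl_sub t (V n)).
  { intros n s x H. apply bex_true in H as (l & Hl & H).
    destruct (proj1 (HT n _) (ex_intro _ s H)) as (t & E & Ht). exists t.
    pose proof (code_str_snum t) as E'. rewrite <- E in E'.
    pose proof (snum_lt t). pose proof (mod_pow2_lt x l).
    assert (l = length t).
    { destruct (Nat.lt_trichotomy l (length t)) as [L|[L|L]]; [|exact L|];
        apply (Nat.pow_le_mono_r 2) in L; try lia; simpl in L; lia. }
    subst l. repeat split; [lia | lia | exact Ht]. }
  (* Trimming never cuts a genuine test: the strings enumerated at level [s] give a list of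
     cylinders inside [V n], to which the measure bound of [V n] applies. *)
  assert (HC : forall n s, cnt s (enum e n s) * 2 ^ n <= 2 ^ s).
  { intros n s. set (L := filter (fun t => enum e n s (snum t)) (all_strs s)).
    assert (HL : forall t, In t L -> length t = s /\ enum e n s (snum t) = true).
    { intros t Ht. apply filter_In in Ht as [H1 H2]. split; [|exact H2].
      now apply all_strs_length. }
    assert (M : max_len L <= s).
    { assert (G : forall t, In t L -> length t <= s) by (intros t Ht; apply HL in Ht; lia).
      clear -G. induction L as [|t L IH]; [simpl; lia|].
      change (max_len (t :: L)) with (Nat.max (length t) (max_len L)).
      apply Nat.max_lub; [apply G; now left | apply IH; intros; apply G; now right]. }
    assert (B : count_cyl (max_len L) L * 2 ^ n <= 2 ^ max_len L).
    { apply (Hm n). apply Forall_forall. intros t Ht. apply HL in Ht as [Hl Ht].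
      apply HE in Ht as (u & H1 & H2 & H3). intros Y HY. apply H3.
      apply prefix_res in HY. apply prefix_res. rewrite H2, <- HY, Hl.
      symmetry. now apply res_mod. }
    rewrite count_cyl_cnt in B by apply max_len_ge.
    transitivity (2 ^ (s - max_len L) * (cnt (max_len L) (in_cyls L) * 2 ^ n)).
    - rewrite Nat.mul_assoc, <- cnt_mod. apply Nat.mul_le_mono_r.
      replace (s - max_len L + max_len L) with s by lia.
      apply cnt_le. intros x Hx H. destruct (snum_ex s x Hx) as (t & Hl & <-).
      assert (Ht : In t L).
      { apply filter_In. split; [|exact H].
        assert (Hin : In (snum t) (map snum (all_strs s)))
          by (rewrite snum_all_strs; apply in_seq; lia).
        apply in_map_iff in Hin as (u & Hu & Hin).
        replace t with u; [exact Hin|]. apply all_strs_length in Hin.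
        assert (I : forall a b, length a = length b -> snum a = snum b -> a = b).
        { clear. induction a as [|p a IH]; intros [|q b] Hl Hs; simpl in *; try easy.
          rewrite (IH b) by (destruct p, q; simpl in Hs; lia).
          f_equal. destruct p, q; simpl in Hs; auto; lia. }
        apply I; congruence. }
      apply existsb_exists. exists t. split; [exact Ht|]. apply Nat.eqb_eq.
      rewrite mod_mod_pow2 by now apply max_len_ge.
      apply Nat.mod_small, snum_lt.
    - replace (2 ^ s) with (2 ^ (s - max_len L) * 2 ^ max_len L)
        by (rewrite <- Nat.pow_add_r; f_equal; lia).
      now apply Nat.mul_le_mono_l. }
  destruct (Ho _ _ (HX (i + S (S e)))) as (t & Ht & Hs).
  destruct (proj2 (HT (i + S (S e)) (code_str t))) as [s H]; [eauto|].
  apply prefix_res in Ht.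
  (* The successor makes [e] smaller than the level, since [univ] at level [s] admits only programs
     below [s]. *)
  exists (S (Nat.max e (Nat.max s (length t)))). apply bex_true. exists e.
  split; [lia|]. apply bex_true. exists (Nat.max s (length t)). split; [lia|].
  rewrite res_mod by lia. apply andb_true_iff. split; [|apply Nat.leb_le, HC].
  apply bex_true. exists (length t). split; [lia|].
  rewrite res_mod, Ht by lia. rewrite <- code_str_snum.
  now apply halts_by_le with s; [lia|].
Qed.

(** * Cylinders kept free of the universal test *)

(** Equals [n] if no [x < n] satisfies [p]. *)
Definition bmin (n : nat) (p : nat -> bool) : nat :=
  bsum n (fun x => Nat.b2n (ball (S x) (fun y => negb (p y)))).

Lemma bmin_spec n p : (exists x, x < n /\ p x = true) -> bmin n p < n /\ p (bmin n p) = true.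
Proof.
  intro H.
  assert (G : forall m, (forall x, x < m -> p x = false) -> bmin m p = m).
  { unfold bmin. induction m as [|m IH]; intro Hm; [reflexivity|]. cbn [bsum].
    rewrite IH by auto. replace (ball (S m) _) with true; [reflexivity|]. symmetry.
    apply ball_true. intros k Hk. now rewrite Hm. }
  unfold bmin in *. induction n as [|n IH]; [destruct H as (x & H & _); lia|].
  cbn [bsum]. destruct (classic (exists x, x < n /\ p x = true)) as [E|E].
  - destruct (IH E) as [H1 H2]. replace (ball (S n) _) with false; [simpl; split; [lia | exact H2]|].
    symmetry. apply not_true_iff_false. intro B. destruct E as (x & Hx & E).
    rewrite ball_true in B. specialize (B x). rewrite E in B. simpl in B.
    discriminate B. lia.
  - assert (F : forall x, x < n -> p x = false).
    { intros x Hx. apply not_true_iff_false. intro. apply E. eauto. }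
    rewrite G by exact F. destruct H as (x & Hx & H).
    assert (x = n) as ->.
    { destruct (Nat.eq_dec x n) as [|N]; [assumption|]. rewrite F in H by lia. discriminate H. }
    replace (ball (S n) _) with false; [simpl; auto|].
    symmetry. apply not_true_iff_false. intro B. rewrite ball_true in B.
    specialize (B n). rewrite H in B. discriminate B. lia.
Qed.

Lemma PR_bmin k n p : PR k n -> PRB (S k) (fun w => p (hd 0 w) (tl w)) ->
  PR k (fun v => bmin (n v) (fun x => p x v)).
Proof.
  intros Hn Hp. unfold bmin. apply (PR_bsum k
    (fun x v => Nat.b2n (ball (S x) (fun y => negb (p y v))))); [exact Hn|].
  apply (PRB_ball (S k) (fun y w => negb (p y (tl w)))); [pr|]. apply PRB_negb.
  apply (PR_subst 2 k (fun y w => Nat.b2n (p y w)) (hd 0)); [exact Hp | pr].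
Qed.
#[global] Hint Resolve PR_bmin : pr.

(** [sg s] is the [s]-th cylinder, of length [s + 2]: the least one avoiding the
    previous cylinders and what [univ 0] has covered so far. [hist s] lists
    [sg (s-1), ..., sg 0]. *)
Definition fresh (s h x : nat) : bool :=
  negb (univ 0 (s + 2) x) &&
  ball s (fun k => negb (x mod 2 ^ (s - 1 - k + 2) =? nnth k h)).

Definition hist (s : nat) : nat :=
  nat_rect (fun _ => nat) 0 (fun s h => ncons (bmin (2 ^ (s + 2)) (fresh s h)) h) s.

Definition sg (s : nat) : nat := nhd (hist (S s)).

Lemma PR_sg k s : PR k s -> PR k (fun v => sg (s v)).
Proof.
  intros. unfold sg, hist. apply PR_nhd. apply PR_rec; [pr| |pr].
  apply PR_ncons; [|pr].
  apply (PR_bmin (S (S k)) _ (fun x w => fresh (hd 0 w) (hd 0 (tl w)) x)); [pr|].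
  unfold fresh. pr.
Qed.
#[global] Hint Resolve PR_sg : pr.

Lemma hist_lcode s : hist s = lcode (map sg (rev (seq 0 s))).
Proof.
  induction s as [|s IH]; [reflexivity|]. rewrite seq_S, rev_app_distr. simpl.
  rewrite <- IH. unfold sg. simpl. now rewrite nhd_cons.
Qed.

Lemma nnth_hist s k : k < s -> nnth k (hist s) = sg (s - 1 - k).
Proof.
  intro H. rewrite hist_lcode, nnth_lcode, map_rev.
  rewrite rev_nth by (rewrite length_map, length_seq; exact H).
  rewrite length_map, length_seq.
  rewrite (nth_indep _ 0 (sg 0)) by (rewrite length_map, length_seq; lia).
  rewrite map_nth, seq_nth by lia. f_equal. lia.
Qed.

(** Among the strings of length [s + 2], [univ 0] takes at most half and the earlier cylinders, of
    measures 1/4, 1/8 and so on, strictly less than half; so [bmin] finds one that is left. *)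
Lemma sg_spec s : sg s < 2 ^ (s + 2) /\ univ 0 (s + 2) (sg s) = false /\
  forall t, t < s -> sg s mod 2 ^ (t + 2) <> sg t.
Proof.
  assert (E : sg s = bmin (2 ^ (s + 2)) (fresh s (hist s)))
    by (unfold sg; simpl; apply nhd_cons).
  rewrite E.
  destruct (bmin_spec (2 ^ (s + 2)) (fresh s (hist s))) as [H1 H2].
  - set (bad := fun x => univ 0 (s + 2) x || bex s (fun t => x mod 2 ^ (t + 2) =? sg t)).
    assert (C : cnt (s + 2) bad < 2 ^ (s + 2)).
    { eapply Nat.le_lt_trans; [apply cnt_or|].
      pose proof (univ_measure 0 (s + 2)) as U. rewrite Nat.pow_1_r in U.
      assert (B : bsum s (fun t => cnt (s + 2) (fun x => x mod 2 ^ (t + 2) =? sg t)) * 2 ^ s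
                  + 2 ^ S s <= 2 ^ S s * 2 ^ s).
      { apply geometric_bound. intros t Ht.
        pose proof (cnt_cyl (t + 2) (s + 2) (sg t)) as Hc.
        replace (s + 2 - (t + 2)) with (s - t) in Hc by lia.
        replace (S s) with ((s - t) + S t) by lia.
        rewrite (Nat.pow_add_r 2 (s - t)).
        apply Nat.mul_le_mono_r, Hc. lia. }
      pose proof (cnt_bex (s + 2) s (fun t x => x mod 2 ^ (t + 2) =? sg t)) as D. simpl in D.
      replace (2 ^ (s + 2)) with (2 * 2 ^ S s) in *
        by (rewrite <- Nat.pow_succ_r'; f_equal; lia).
      pose proof (Nat.pow_nonzero 2 (S s)).
      assert (bsum s (fun t => cnt (s + 2) (fun x => x mod 2 ^ (t + 2) =? sg t)) < 2 ^ S s)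
        by nia.
      lia. }
    assert (N : exists x, x < 2 ^ (s + 2) /\ bad x = false).
    { apply NNPP. intro N. apply (Nat.lt_irrefl (2 ^ (s + 2))).
      eapply Nat.le_lt_trans; [|exact C].
      assert (T : forall n, n <= 2 ^ (s + 2) -> n <= bsum n (fun x => Nat.b2n (bad x))).
      { induction n as [|n IH]; intro Hn; cbn [bsum]; [lia|]. destruct (bad n) eqn:Eb.
        - cbn [Nat.b2n]. assert (n <= bsum n (fun x => Nat.b2n (bad x))) by (apply IH; lia). lia.
        - destruct N. eauto. }
      now apply T. }
    destruct N as (x & Hx & N). exists x. split; [exact Hx|]. unfold bad in N.
    apply orb_false_iff in N as [N1 N2]. unfold fresh. rewrite N1. simpl.
    apply ball_true. intros k Hk. rewrite nnth_hist by exact Hk.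
    apply negb_true_iff, not_true_iff_false. intro Hq. apply not_true_iff_false in N2.
    apply N2, bex_true. exists (s - 1 - k). split; [lia | exact Hq].
  - unfold fresh in H2 at 1. apply andb_true_iff in H2 as [H2 H3].
    apply negb_true_iff in H2. repeat split; auto.
    intros t Ht Hq. rewrite ball_true in H3. specialize (H3 (s - 1 - t)).
    rewrite nnth_hist in H3 by lia. replace (s - 1 - (s - 1 - t)) with t in H3 by lia.
    rewrite Hq, Nat.eqb_refl in H3. simpl in H3. discriminate H3. lia.
Qed.

(** The numerical value of a string shorter than [j + 2] may equal [sg j] by accident; the guard on
    the length excludes this. *)
Definition incyl (j s x : nat) : bool := (j + 2 <=? s) && (x mod 2 ^ (j + 2) =? sg j).

Lemma incyl_true j s x : incyl j s x = true <-> j + 2 <= s /\ x mod 2 ^ (j + 2) = sg j.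
Proof. unfold incyl. now rewrite andb_true_iff, Nat.leb_le, Nat.eqb_eq. Qed.

Lemma incyl_inj j j' s x : incyl j s x = true -> incyl j' s x = true -> j = j'.
Proof.
  assert (H : forall j j', j < j' -> incyl j s x = true -> incyl j' s x = true -> False).
  { intros a b Hab H H'. apply incyl_true in H as [_ H]. apply incyl_true in H' as [_ H'].
    apply (proj2 (proj2 (sg_spec b)) a Hab). rewrite <- H', mod_mod_pow2 by lia. exact H. }
  intros H1 H2. destruct (Nat.lt_trichotomy j j') as [L|[L|L]]; [|exact L|];
    exfalso; eauto.
Qed.

Lemma incyl_mono j s t x : s <= t -> incyl j s (x mod 2 ^ s) = true -> incyl j t x = true.
Proof.
  rewrite !incyl_true. intros Hs [H1 H2]. rewrite mod_mod_pow2 in H2 by lia. split; [lia | easy].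
Qed.

Lemma incyl_measure j s : cnt s (incyl j s) * 2 ^ (j + 2) <= 2 ^ s.
Proof.
  destruct (Nat.le_gt_cases (j + 2) s) as [L|L].
  - transitivity (2 ^ (s - (j + 2)) * 2 ^ (j + 2)).
    + apply Nat.mul_le_mono_r. etransitivity; [|now apply cnt_cyl with (y := sg j)].
      apply cnt_le. intros x _ H. apply incyl_true in H. now apply Nat.eqb_eq.
    + rewrite <- Nat.pow_add_r. apply Nat.pow_le_mono_r; lia.
  - replace (cnt s (incyl j s)) with 0; [simpl; lia|].
    unfold cnt, incyl. apply Nat.leb_gt in L. rewrite L. simpl.
    induction (2 ^ s); simpl in *; lia.
Qed.

Lemma PRB_incyl k j s x : PR k j -> PR k s -> PR k x ->
  PRB k (fun v => incyl (j v) (s v) (x v)).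
Proof. intros. unfold incyl. pr. Qed.
#[global] Hint Resolve PRB_incyl : pr.

(** * The two tests *)

(** The successor puts the cylinders at indices above [p]. As [pair i k] is at least [i], those that
    [wtest i] may swallow have indices above [i] and total measure at most 2^-(i+2). *)
Definition vtest (p s x : nat) : bool := bex s (fun n => incyl (S (pair p n)) s x).

Definition filled (i j s : nat) : bool :=
  bex (S j) (fun k => bex (S j) (fun n =>
    (j =? S (pair (pair i k) n)) && bex (S s) (fun m => witness i k n m))).

(** In the second part the stage [t] is frozen: only cylinders visible at [t] are tested, and what
    is enumerated then is kept. A longer cylinder, chosen later, avoids what [univ 0] covered at
    stage [t], hence this part. *)
Definition wtest (i s x : nat) : bool :=
  bex s (fun j => incyl j s x && (filled i j s || univ (i + S (S j)) s x)) ||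
  bex (S s) (fun t => univ 0 t (x mod 2 ^ t) && univ i t (x mod 2 ^ t) &&
                      ball t (fun j => negb (incyl j t x))).

Lemma PRB_vtest k p s x : PR k p -> PR k s -> PR k x ->
  PRB k (fun v => vtest (p v) (s v) (x v)).
Proof. intros. unfold vtest. pr. Qed.

Lemma PRB_filled k i j s : PR k i -> PR k j -> PR k s ->
  PRB k (fun v => filled (i v) (j v) (s v)).
Proof. intros. unfold filled. pr. Qed.
#[global] Hint Resolve PRB_filled : pr.

Lemma PRB_wtest k i s x : PR k i -> PR k s -> PR k x ->
  PRB k (fun v => wtest (i v) (s v) (x v)).
Proof. intros. unfold wtest. pr. Qed.

Lemma filled_true i j s : filled i j s = true <->
  exists k n m, j = S (pair (pair i k) n) /\ m <= s /\ witness i k n m = true.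
Proof.
  unfold filled. rewrite bex_true. split.
  - intros (k & _ & H). apply bex_true in H as (n & _ & H).
    apply andb_true_iff in H as [H1 H2]. apply Nat.eqb_eq in H1.
    apply bex_true in H2 as (m & H2 & H3). exists k, n, m. repeat split; auto; lia.
  - intros (k & n & m & Hj & Hm & H). pose proof (pair_ge (pair i k) n).
    pose proof (pair_ge i k). exists k. split; [lia|]. apply bex_true. exists n.
    split; [lia|]. apply andb_true_iff. split; [now apply Nat.eqb_eq|].
    apply bex_true. exists m. split; [lia | exact H].
Qed.

Lemma vtest_mono p : mono (vtest p).
Proof. intros s t x Hs. apply bex_mono; [exact Hs|]. intros n _. now apply incyl_mono. Qed.

Lemma wtest_mono i : mono (wtest i).
Proof.
  intros s t x Hs H. unfold wtest in *. apply orb_true_iff in H. apply orb_true_iff.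
  destruct H as [H|H]; [left|right]; revert H; apply bex_mono; try lia.
  - intros j _ H. apply andb_true_iff in H as [H1 H2]. apply andb_true_iff.
    split; [now apply (incyl_mono j s)|]. apply orb_true_iff in H2. apply orb_true_iff.
    destruct H2 as [H2|H2]; [left | right; now apply (univ_mono _ s)].
    apply filled_true in H2 as (k & n & m & Hj & Hm & H2). apply filled_true.
    exists k, n, m. repeat split; auto; lia.
  - intros r Hr H. rewrite mod_mod_pow2 in H by lia.
    apply andb_true_iff in H as [H1 H2]. apply andb_true_iff. split; [exact H1|].
    rewrite ball_true in *. intros j Hj. specialize (H2 j Hj).
    apply negb_true_iff in H2. apply negb_true_iff. unfold incyl in *.
    destruct (Nat.leb_spec (j + 2) r) as [L|L]; [|reflexivity].
    now rewrite mod_mod_pow2 in H2 by lia.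
Qed.

Lemma vtest_measure p s : cnt s (vtest p s) * 2 ^ p <= 2 ^ s.
Proof.
  apply cnt_bex_geometric. intros n _.
  etransitivity; [|apply (incyl_measure (S (pair p n)))].
  apply Nat.mul_le_mono_l, Nat.pow_le_mono_r; [lia|]. pose proof (pair_ge p n). lia.
Qed.

(** The budget is 2^-(i+2) for the swallowed cylinders, 2^-(i+2) for the copies of [univ] inside
    cylinders, and 2^-(i+1) for the part outside. *)
Lemma wtest_measure i s : cnt s (wtest i s) * 2 ^ i <= 2 ^ s.
Proof.
  set (A := fun x => bex s (fun e => incyl (i + S e) s x)).
  set (B := fun x => bex s (fun e => univ (i + S (S e)) s x)).
  assert (H : cnt s (wtest i s) <= (cnt s A + cnt s B) + cnt s (univ i s)).
  { etransitivity; [|apply Nat.add_le_mono_r, cnt_or].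
    etransitivity; [|apply cnt_or]. apply cnt_le. intros x Hx H.
    apply orb_true_iff in H. rewrite !orb_true_iff. destruct H as [H|H].
    - left. apply bex_true in H as (j & Hj & H). apply andb_true_iff in H as [H1 H2].
      apply orb_true_iff in H2 as [H2|H2]; [left | right; apply bex_true; eauto].
      apply filled_true in H2 as (k & n & m & E & _). pose proof (pair_ge (pair i k) n).
      pose proof (pair_ge i k). apply bex_true. exists (j - S i). split; [lia|].
      now replace (i + S (j - S i)) with j by lia.
    - right. apply bex_true in H as (t & Ht & H). apply andb_true_iff in H as [H _].
      apply andb_true_iff in H as [_ H]. apply (univ_mono i t); [lia | exact H]. }
  assert (HA : cnt s A * 2 ^ S (S i) <= 2 ^ s).
  { apply cnt_bex_geometric. intros e _.
    replace (S (S i) + S e) with (i + S e + 2) by lia. apply incyl_measure. }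
  assert (HB : cnt s B * 2 ^ S (S i) <= 2 ^ s).
  { apply cnt_bex_geometric. intros e _.
    replace (S (S i) + S e) with (S (i + S (S e))) by lia. apply univ_measure. }
  pose proof (univ_measure i s) as HC. rewrite !Nat.pow_succ_r' in *. nia.
Qed.

Lemma vtest_ML : ML_test (fun p => lev (vtest p)).
Proof. apply ML_test_lev; [apply vtest_mono | apply PRB_vtest | apply vtest_measure]. Qed.

Lemma wtest_ML : ML_test (fun i => lev (wtest i)).
Proof. apply ML_test_lev; [apply wtest_mono | apply PRB_wtest | apply wtest_measure]. Qed.

(** A point of all [univ i] either lies in some cylinder [j], where [univ (i + j + 2)] catches it,
    or in none, and then no cylinder test ever blocks it. *)
Lemma wtest_universal : universal_ML_test (fun i => lev (wtest i)).
Proof.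
  split; [exact wtest_ML|]. intros V HV X HX i.
  pose proof (univ_universal V HV X HX) as U.
  destruct (classic (exists j, res X (j + 2) = sg j)) as [[j Hj]|N].
  - destruct (U (i + S (S j))) as [s Hs]. exists (Nat.max s (j + 2)).
    apply orb_true_iff. left. apply bex_true. exists j. split; [lia|].
    apply andb_true_iff. split.
    + apply incyl_true. split; [lia|]. now rewrite res_mod by lia.
    + apply orb_true_iff. right. apply (univ_mono _ s); [lia|]. now rewrite res_mod by lia.
  - destruct (U 0) as [s Hs]. destruct (U i) as [t Ht]. exists (Nat.max s t).
    apply orb_true_iff. right. apply bex_true. exists (Nat.max s t). split; [lia|].
    rewrite res_mod by lia. rewrite !andb_true_iff. repeat split.
    + apply (univ_mono _ s); [lia|]. now rewrite res_mod by lia.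
    + apply (univ_mono _ t); [lia|]. now rewrite res_mod by lia.
    + apply ball_true. intros j _. apply negb_true_iff, not_true_iff_false. intro H.
      apply incyl_true in H as [H1 H2]. rewrite res_mod in H2 by exact H1. eauto.
Qed.

(** * Inclusions between the two tests *)

Lemma vtest_sub_wtest i k : (forall n, exists m, witness i k n m = true) ->
  set_sub (lev (vtest (pair i k))) (lev (wtest i)).
Proof.
  intros H X [s Hs]. apply bex_true in Hs as (n & Hn & Hs). destruct (H n) as [m Hm].
  exists (Nat.max s m). apply orb_true_iff. left. apply bex_true.
  exists (S (pair (pair i k) n)). apply incyl_true in Hs as [H1 H2]. split; [lia|].
  apply andb_true_iff. split.
  - apply incyl_true. split; [lia|]. rewrite res_mod in * by lia. exact H2.
  - apply orb_true_iff. left. apply filled_true. exists k, n, m. repeat split; auto; lia.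
Qed.

(* Inside the [j]-th cylinder, of measure [2 ^ -(j + 2)], the set [wtest i] is everything if
   [filled i j s] holds for some [s], and otherwise has measure at most
   [2 ^ -(i + j + 3)]. *)
Lemma cylinder_sub_wtest i j : (forall X, res X (j + 2) = sg j -> lev (wtest i) X) ->
  exists s, filled i j s = true.
Proof.
  intro H. apply NNPP. intro N.
  apply lev_compact in H as (m & Hm & H); [|apply wtest_mono].
  destruct (sg_spec j) as (G1 & G2 & _).
  assert (C : forall x, x < 2 ^ m -> x mod 2 ^ (j + 2) = sg j ->
    univ (i + S (S j)) m x = true).
  { intros x Hx Hj. specialize (H x Hx Hj). apply orb_true_iff in H as [H|H].
    - apply bex_true in H as (j' & _ & H). apply andb_true_iff in H as [H1 H2].
      assert (j' = j) as ->.
      { apply (incyl_inj j' j m x H1). apply incyl_true. now split. }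
      apply orb_true_iff in H2 as [H2|H2]; [|exact H2]. destruct N. eauto.
    (* The part outside the cylinders cannot reach into this one: at a stage [t] of at least [j + 2]
       the cylinder is tested explicitly, and before that [sg j] avoids [univ 0]. *)
    - exfalso. apply bex_true in H as (t & Ht & H). rewrite !andb_true_iff in H.
      destruct H as ((H1 & _) & H2). destruct (Nat.le_gt_cases (j + 2) t) as [L|L].
      + rewrite ball_true in H2. specialize (H2 j). rewrite negb_true_iff in H2.
        assert (E : incyl j t x = true) by (apply incyl_true; now split).
        rewrite H2 in E; [discriminate E | lia].
      + rewrite (univ_mono 0 t (j + 2) (sg j)) in G2; [discriminate G2 | lia |].
        rewrite <- Hj, mod_mod_pow2 by lia. exact H1. }
  assert (D : cnt m (fun x => x mod 2 ^ (j + 2) =? sg j) <= cnt m (univ (i + S (S j)) m)).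
  { apply cnt_le. intros x Hx E. apply Nat.eqb_eq in E. auto. }
  assert (P : 1 <= cnt (j + 2) (fun x => x =? sg j)).
  { unfold cnt. replace (2 ^ (j + 2)) with (sg j + (1 + (2 ^ (j + 2) - S (sg j)))) by lia.
    rewrite !bsum_split. cbn [bsum].
    rewrite !Nat.add_0_r, Nat.eqb_refl. simpl. lia. }
  replace m with ((m - (j + 2)) + (j + 2)) in D at 1 by lia.
  rewrite (cnt_mod (j + 2) (m - (j + 2)) (fun x => x =? sg j)) in D.
  pose proof (univ_measure (i + S (S j)) m) as U.
  assert (E : 2 ^ m = 2 ^ (m - (j + 2)) * 2 ^ (j + 2))
    by (rewrite <- Nat.pow_add_r; f_equal; lia).
  replace (S (i + S (S j))) with (S i + (j + 2)) in U by lia.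
  rewrite Nat.pow_add_r, E in U. rewrite Nat.pow_succ_r' in U.
  pose proof (Nat.pow_nonzero 2 (m - (j + 2))). pose proof (Nat.pow_nonzero 2 (j + 2)).
  pose proof (Nat.pow_nonzero 2 i).
  set (a := 2 ^ (m - (j + 2))) in *. set (b := 2 ^ (j + 2)) in *. set (c := 2 ^ i) in *.
  set (q := cnt m (univ (i + S (S j)) m)) in *.
  assert (a <= q) by nia.
  assert (q * (2 * c) <= a).
  { apply (Nat.mul_le_mono_pos_r _ _ b); lia. }
  nia.
Qed.

(** Each cylinder of [vtest p] must be swallowed, and its index determines which [i] and [k] swallow
    it; by injectivity of pairing the same [k], the second component of [p], serves all [n]. *)
Lemma vtest_sub_wtest_inv i p : set_sub (lev (vtest p)) (lev (wtest i)) ->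
  p = pair i (usnd p) /\ forall n, exists m, witness i (usnd p) n m = true.
Proof.
  intro H.
  assert (A : forall n, exists k m, p = pair i k /\ witness i k n m = true).
  { intro n. destruct (cylinder_sub_wtest i (S (pair p n))) as [s Hs].
    - intros X HX. apply H. exists (S (pair p n) + 2). apply bex_true. exists n.
      pose proof (pair_ge p n). split; [lia|]. apply incyl_true. split; [lia|].
      now rewrite res_mod by lia.
    - apply filled_true in Hs as (k & n' & m & E & _ & W). injection E as E.
      apply pair_inj in E as [-> ->]. eauto. }
  split.
  - destruct (A 0) as (k & m & -> & _). now rewrite usnd_pair.
  - intro n. destruct (A n) as (k & m & -> & W). rewrite usnd_pair. eauto.
Qed.

Theorem theorem3p4 :
  exists W V : nat -> cantor -> Prop,
    ML_test W /\ ML_test V /\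
    universal_ML_test W /\
    (forall i, exists j, set_sub (V j) (W i)) /\
    (forall f : nat -> nat,
        (forall i, set_sub (V (f i)) (W i)) -> turing_above_0'' f).
Proof.
  exists (fun i => lev (wtest i)), (fun p => lev (vtest p)).
  split; [exact wtest_ML|]. split; [exact vtest_ML|]. split; [exact wtest_universal|].
  split.
  - intro i. destruct (witness_ex i) as [k Hk]. exists (pair i k).
    now apply vtest_sub_wtest.
  - intros f Hf.
    (* A [PR] program works under every oracle, so one query to [f] followed by a zero test of the
       second component decides 0''; value 0 means non-membership. *)
    assert (P : PR 1 (fun v => if usnd (hd 0 v) =? 0 then 0 else 1)) by pr.
    destruct P as [c Hc]. exists (PComp c [POracle]). intro x.
    assert (E : eval (graph_fun f) (PComp c [POracle]) [x]
                  (if usnd (f x) =? 0 then 0 else 1)).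
    { apply ev_comp with [f x].
      - constructor; [now constructor | constructor].
      - now apply (Hc (graph_fun f) [f x]). }
    destruct (vtest_sub_wtest_inv x (f x) (Hf x)) as [_ Hw].
    destruct (usnd (f x)) as [|k]; simpl in E.
    + split; [|now intro]. intro Hx. now apply witness_0 in Hw.
    + split; [now intro|]. intro Hx. destruct Hx. now apply witness_S in Hw.
Qed.
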